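(* Let $\alpha\in(0,1)$ and, for each positive integer $d$, let $S$ be the SRRW on $(\mathbb{Z}_2^d,+)$ with reinforcement parameter $\alpha$ and step distribution $\mu$ given by $$\mu(e_G)=\frac12,\qquad \mu(e_k)=\frac1{2d},\quad k=1,2,\dots,d,$$ where $e_G$ is the zero vector of $\mathbb{Z}_2^d=\{0,1\}^d$ and $e_k$ is the vector with $1$ in the $k$-th position and zeros elsewhere. Let $t^{(\alpha)}_{\mathrm{mix}}(\varepsilon)$ (depending on $d$) be its $\varepsilon$-mixing time. Then for any fixed $\varepsilon\in(0,1)$, as $d\to\infty$, $$t^{(\alpha)}_{\mathrm{mix}}(\varepsilon)=\frac{d\log d}{(1-\alpha)\ {}_2F_1(1,\alpha^{-1};\alpha^{-1}+1;\frac12)}+O_{\alpha,\varepsilon}(d),$$ where the constant implied in $O_{\alpha,\varepsilon}(d)$ depends only on $\alpha$ and $\varepsilon$, and $${}_2F_1(a,b;c;z)=\sum_{m=0}^\infty\frac{(a)_m(b)_m}{(c)_m}\frac{z^m}{m!},$$ with $(a)_0=1$ and $(a)_m=a(a+1)\cdots(a+m-1)$ for $m\ge1$.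
   Context: SRRW: Let $(G,\cdot)$ be a discrete group with $|G|\ge2$ and identity $e_G$, $\mu$ a probability measure on $G$, and $\alpha\in[0,1)$. Let $(\xi_n)_{n\ge2}$ be i.i.d. Bernoulli random variables with $\mathbb{P}(\xi_n=1)=\alpha$, and let $(u_n)_{n\ge2}$ be independent with $u_n$ uniform on $\{1,\dots,n-1\}$; these two sequences and all fresh samples from $\mu$ below are independent. Set $S_0=e_G$; sample $X_1$ from $\mu$ and set $S_1=X_1$. For $n>1$: if $\xi_n=1$ set $X_n=X_{u_n}$; if $\xi_n=0$ sample $X_n$ afresh from $\mu$; put $S_n=S_{n-1}\cdot X_n$. The process $(S_n)$ is the SRRW on $G$ (started at $e_G$) with step distribution $\mu$ and reinforcement parameter $\alpha$. Mixing time: with $U$ the uniform measure on the finite group $G$ and $\|\nu_1-\nu_2\|_{\mathrm{TV}}=\frac12\sum_{g\in G}|\nu_1(g)-\nu_2(g)|$, $$t^{(\alpha)}_{\mathrm{mix}}(\varepsilon)=\inf\{n\ge1:\ \|\mathbb{P}(S_m=\cdot)-U\|_{\mathrm{TV}}\le\varepsilon\ \text{ for all } m\ge n\}.$$ *)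

(* Defs.v *)
From HB Require Import structures.
From mathcomp Require Import all_boot all_order all_algebra all_fingroup.
From mathcomp Require Import all_classical all_reals all_analysis.

Set Implicit Arguments.
Unset Strict Implicit.
Unset Printing Implicit Defensive.

Import Order.TTheory GRing.Theory Num.Theory.
Import numFieldNormedType.Exports.
Local Open Scope classical_set_scope.
Local Open Scope ring_scope.

(* Random variables with values in a countable discrete space (here bool, nat
   or a finite group): measurability is measurability of the fibres, and the
   distribution and independence are determined by the point masses. *)
Definition discrete_rv (disp : measure_display) (T : measurableType disp)
    (E : Type) (X : T -> E) : Prop :=
  forall x : E, measurable [set w | X w = x].

Definition mutually_independent (R : realType) (disp : measure_display)
    (T : measurableType disp) (P : probability T R) (I : eqType)
    (E : I -> Type) (Z : forall i : I, T -> E i) : Prop :=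
  forall (s : seq I) (x : forall i : I, E i), uniq s ->
    P [set w | forall i, i \in s -> Z i w = x i] =
    (\prod_(i <- s) P [set w | Z i w = x i])%E.

(* The sources of randomness (xi_n)_{n >= 2}, (u_n)_{n >= 2} and the fresh
   samples (Y_n)_{n >= 1}, gathered in one family indexed by
   nat + nat + nat; the shifts n.+2 and n.+1 discard the unused indices. *)
Definition source_type (G : Type) (i : nat + nat + nat) : Type :=
  match i with
  | inl (inl _) => bool
  | inl (inr _) => nat
  | inr _ => G
  end.

Definition source (T G : Type) (xi : nat -> T -> bool) (u : nat -> T -> nat)
    (Y : nat -> T -> G) (i : nat + nat + nat) : T -> source_type G i :=
  match i return T -> source_type G i with
  | inl (inl n) => xi n.+2
  | inl (inr n) => u n.+2
  | inr n => Y n.+1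
  end.

(* (S_n) is the SRRW driven by xi, u and Y, with increments (X_n)_{n >= 1}.
   The step distribution is given by its mass function mu. *)
Record srrw_construction (R : realType) (disp : measure_display)
    (T : measurableType disp) (P : probability T R) (G : finGroupType)
    (mu : G -> R) (alpha : R)
    (xi : nat -> T -> bool) (u : nat -> T -> nat) (Y : nat -> T -> G)
    (X S : nat -> T -> G) : Prop := SRRWConstruction {
  srrw_xi_rv : forall n, (2 <= n)%N -> discrete_rv (xi n);
  srrw_u_rv : forall n, (2 <= n)%N -> discrete_rv (u n);
  srrw_Y_rv : forall n, (1 <= n)%N -> discrete_rv (Y n);
  srrw_xi_law : forall n, (2 <= n)%N ->
    P [set w | xi n w = true] = alpha%:E;
  srrw_u_range : forall n w, (2 <= n)%N -> (1 <= u n w < n)%N;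
  srrw_u_law : forall n k, (2 <= n)%N -> (1 <= k < n)%N ->
    P [set w | u n w = k] = (n.-1%:R^-1)%:E;
  srrw_Y_law : forall n g, (1 <= n)%N ->
    P [set w | Y n w = g] = (mu g)%:E;
  srrw_indep : mutually_independent P (source xi u Y);
  srrw_X1 : forall w, X 1%N w = Y 1%N w;
  srrw_X : forall n w, (2 <= n)%N ->
    X n w = if xi n w then X (u n w) w else Y n w;
  srrw_S0 : forall w, S 0%N w = 1%g;
  srrw_S : forall n w, (1 <= n)%N -> S n w = (S n.-1 w * X n w)%g
}.

Definition is_srrw (R : realType) (disp : measure_display)
    (T : measurableType disp) (P : probability T R) (G : finGroupType)
    (mu : G -> R) (alpha : R) (S : nat -> T -> G) : Prop :=
  exists (xi : nat -> T -> bool) (u : nat -> T -> nat) (Y X : nat -> T -> G),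
    srrw_construction P mu alpha xi u Y X S.

Definition tv_dist (R : realType) (G : finType) (nu1 nu2 : G -> R) : R :=
  2%:R^-1 * \sum_(g : G) `|nu1 g - nu2 g|.

Definition pmf (R : realType) (disp : measure_display)
    (T : measurableType disp) (P : probability T R) (G : finType)
    (X : T -> G) (g : G) : R :=
  fine (P [set w | X w = g]).

Definition unif (R : realType) (G : finType) (g : G) : R := #|G|%:R^-1.

(* Valued in \bar R, so that the infimum of the empty set is +oo. *)
Definition tmix (R : realType) (disp : measure_display)
    (T : measurableType disp) (P : probability T R) (G : finType)
    (S : nat -> T -> G) (eps : R) : \bar R :=
  ereal_inf [set (n%:R : R)%:E | n in [set n : nat | (1 <= n)%N /\
    forall m, (n <= m)%N -> tv_dist (pmf P (S m)) (@unif R G) <= eps]].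

(* 'rV['Z_2]_d carries the finGroupType structure of its additive group, in
   which the group law is +%R and the identity is the zero vector. *)
Definition hypercube (d : nat) : finGroupType := 'rV['Z_2]_d.

Definition hypercube_step (R : realType) (d : nat) (g : hypercube d) : R :=
  if (g : 'rV['Z_2]_d) == 0 then 2%:R^-1
  else if [exists k : 'I_d, (g : 'rV['Z_2]_d) == delta_mx 0 k]
  then (2 * d%:R)^-1
  else 0.

Definition pochhammer (R : realType) (a : R) (m : nat) : R :=
  \prod_(0 <= i < m) (a + i%:R).

Definition hyp2F1 (R : realType) (a b c z : R) : R :=
  limn (series (fun m : nat =>
    pochhammer a m * pochhammer b m / pochhammer c m * (z ^+ m / m`!%:R))).

(* Main.v *)
Require Import Defs.
From mathcomp Require Import all_boot all_order all_algebra all_fingroup.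
From mathcomp Require Import all_classical all_reals all_analysis.
From mathcomp Require Import ring lra zify.

Set Implicit Arguments.
Unset Strict Implicit.
Unset Printing Implicit Defensive.

Import Order.TTheory GRing.Theory Num.Theory.
Import numFieldNormedType.Exports.
Local Open Scope ring_scope.

(** Group the times into clusters, each time joining the cluster of the time
    that it copies. All increments of a cluster equal its one fresh sample, so
    in a group of exponent two a cluster of odd size contributes this sample and
    a cluster of even size contributes nothing. If [K_n] is the number of odd
    clusters at time [n], then [S_n] has the law of the ordinary lazy walk at the
    random time [K_n], independent of its steps ([pmf_srrw]). The lazy walk mixes
    at [(d log d) / 2] with a window of order [d], so it remains to show that
    [K_n] is close to [c n] with [c = (1 - alpha) F / 2], where [F] is the
    hypergeometric value; this [c] is [speed] below.

    Concentration of [K_n]. Put one bit on each time and remove the times from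
    the last to the first: the last time is either a fresh sample, and then its
    bit is counted, or it adds its bit modulo 2 to a uniformly chosen earlier
    time. Starting from ones only, the final count is [K_n]. Flipping one initial
    bit changes the mean of the count by at most 1 ([odd_mean_flipb]), so each
    removal adds at most 1 to the variance and [Var K_n <= n]
    ([odd_expect_sqr_le]).

    Mean of [K_n]. A cluster of size [N] at time [m] grows with probability
    [alpha N / m]. For [w_m = 1 - 2 / (2 - (m/n)^alpha)] the power [w_m ^ N] is a
    martingale up to an error of order [N^2 / m^2] in each step
    ([oddness_step]), and [w_n = -1], so that it predicts the final parity. The
    sum of the squared sizes has mean [O(m^(1 + alpha))], hence the errors add up
    to [O(n^alpha)]. A cluster born at time [m] is therefore odd at time [n] with
    probability about [1 / (2 - (m/n)^alpha)]; expanding this into a geometric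
    series and summing over [m] gives [n F / 2] up to a bounded error
    ([odd_mean_asymptotics]).

    The total deviation [O(n^alpha + n^(1/2))] is [O(n / log d)] when [n >= d]
    ([odd_clusters_concentrate]), that is [O(d)] for [n] of order [d log d]. The
    upper bound on the mixing time then follows from the characters of the
    hypercube ([tv_lazy_law_le]), and the lower bound from Chebyshev's inequality
    for the number of zeros minus the number of ones in a vector ([tv_lower]). *)

(** * Reinforced sampling and the elimination of copies *)

Section Reinforcement.
Variables (R : realType) (alpha : R).

(** The probability that the item following [m] items is a copy: the very first
    item has nothing to copy. *)
Definition copy_prob (m : nat) : R := if m == 0 then 0 else alpha.

(** The expectation of [Phi] over the list, newest item first, of [n] items of a
    reinforced sequence. The law of a fresh item is given by its expectation
    operator [fresh], so that the same recursion covers the increments of the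
    walk and the labels of the clusters. *)
Fixpoint reinforced (T : Type) (x0 : T) (fresh : nat -> (T -> R) -> R) (n : nat)
    (Phi : seq T -> R) : R :=
  if n is m.+1 then
    reinforced x0 fresh m (fun c =>
      (1 - copy_prob m) * fresh m (fun y => Phi (y :: c)) +
      copy_prob m / m%:R * \sum_(k < m) Phi (nth x0 c k :: c))
  else Phi [::].

Lemma reinforcedS (T : Type) (x0 : T) fresh m (Phi : seq T -> R) :
  reinforced x0 fresh m.+1 Phi = reinforced x0 fresh m (fun c =>
    (1 - copy_prob m) * fresh m (fun y => Phi (y :: c)) +
    copy_prob m / m%:R * \sum_(k < m) Phi (nth x0 c k :: c)).
Proof. by []. Qed.

(** Bits are indexed by the positions in the list of items, so position 0 is
    the newest item. *)
Definition tailb (b : nat -> bool) : nat -> bool := fun k => b k.+1.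
Definition flipb (b : nat -> bool) (k : nat) : nat -> bool :=
  fun l => b l (+) (l == k).

(** The expectation of [phi] at the number of clusters whose bits have an odd
    sum, computed by removing the newest item: a fresh item counts its bit, and a
    copy moves its bit to the position that it copies. *)
Fixpoint odd_expect (n : nat) (b : nat -> bool) (phi : nat -> R) : R :=
  if n is m.+1 then
    if b 0 then
      (1 - copy_prob m) * odd_expect m (tailb b) (phi \o S) +
      copy_prob m / m%:R * \sum_(k < m) odd_expect m (flipb (tailb b) k) phi
    else odd_expect m (tailb b) phi
  else phi 0.

Lemma copy_prob_sum m (F : 'I_m -> R) x : (forall k, F k = x) ->
  copy_prob m / m%:R * \sum_(k < m) F k = copy_prob m * x.
Proof.
move=> Fx; rewrite (eq_bigr (fun=> x)) // sumr_const card_ord.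
rewrite /copy_prob; case: m F Fx => [|m] F Fx /=; first by rewrite !mul0r.
by rewrite -(mulr_natl x) mulrA divfK // pnatr_eq0.
Qed.

Section ReinforcedLinearity.
Variables (T : Type) (x0 : T) (fresh : nat -> (T -> R) -> R).
Hypothesis fresh_lin : forall m a f g,
  fresh m (fun y => a * f y + g y) = a * fresh m f + fresh m g.

Lemma reinforced_lin n a Phi Psi :
  reinforced x0 fresh n (fun c => a * Phi c + Psi c)
  = a * reinforced x0 fresh n Phi + reinforced x0 fresh n Psi.
Proof.
elim: n Phi Psi => [|m IH] Phi Psi //=.
rewrite -IH; congr (reinforced _ _ _ _); apply/funext => c.
rewrite fresh_lin big_split /= -mulr_sumr; ring.
Qed.

Lemma reinforced0 n : reinforced x0 fresh n (fun=> 0) = 0.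
Proof.
have E := @reinforced_lin n (-1) (fun=> 0) (fun=> 0).
apply: etrans (etrans E _); last by rewrite mulN1r addNr.
by congr (reinforced _ _ _ _); apply/funext => c; rewrite mulr0 addr0.
Qed.

Lemma reinforcedZ n a Phi : reinforced x0 fresh n (fun c => a * Phi c)
  = a * reinforced x0 fresh n Phi.
Proof.
rewrite -[RHS]addr0 -[X in _ + X](reinforced0 n) -reinforced_lin.
by congr (reinforced _ _ _ _); apply/funext => c; rewrite addr0.
Qed.

Lemma reinforced_sum n (I : Type) (r : seq I) (F : I -> seq T -> R) :
  reinforced x0 fresh n (fun c => \sum_(i <- r) F i c)
  = \sum_(i <- r) reinforced x0 fresh n (F i).
Proof.
elim: r => [|i r IH].
  rewrite big_nil -[RHS](reinforced0 n).
  by congr (reinforced _ _ _ _); apply/funext => c; rewrite big_nil.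
rewrite big_cons -IH -[X in X + _]mul1r -reinforced_lin.
by congr (reinforced _ _ _ _); apply/funext => c; rewrite big_cons mul1r.
Qed.
End ReinforcedLinearity.

Lemma eq_odd_expect n b phi psi :
  phi =1 psi -> odd_expect n b phi = odd_expect n b psi.
Proof. by move=> /funext ->. Qed.

Lemma odd_expect_lin n b a phi psi :
  odd_expect n b (fun k => a * phi k + psi k)
  = a * odd_expect n b phi + odd_expect n b psi.
Proof.
elim: n b phi psi => [|m IH] b phi psi //=; case: ifP => _; last exact: IH.
have -> : (fun k => a * phi k + psi k) \o S
        = (fun k => a * (phi \o S) k + (psi \o S) k) by [].
rewrite IH (eq_bigr (fun k : 'I_m => a * odd_expect m (flipb (tailb b) k) phi
   + odd_expect m (flipb (tailb b) k) psi)) => [|k _]; last exact: IH.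
rewrite big_split /= -mulr_sumr; ring.
Qed.

Lemma odd_expect_const n b c : odd_expect n b (fun=> c) = c.
Proof.
elim: n b c => [|m IH] b c //=; case: ifP => _ //.
have -> : (fun=> c) \o S = (fun=> c) :> (nat -> R) by [].
by rewrite IH (@copy_prob_sum _ _ c) // mulrBl mul1r subrK.
Qed.

Lemma odd_expect0 n b : odd_expect n b (fun=> 0) = 0.
Proof. exact: odd_expect_const. Qed.

Lemma odd_expectZ n b a phi :
  odd_expect n b (fun k => a * phi k) = a * odd_expect n b phi.
Proof.
rewrite -[RHS]addr0 -[X in _ + X](odd_expect0 n b) -odd_expect_lin.
by apply: eq_odd_expect => k; rewrite addr0.
Qed.

Lemma odd_expectD n b phi psi :
  odd_expect n b (fun k => phi k + psi k) = odd_expect n b phi + odd_expect n b psi.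
Proof.
rewrite -[X in _ = X + _]mul1r -odd_expect_lin; apply: eq_odd_expect => k.
by rewrite mul1r.
Qed.

Lemma odd_expect_sum n b (I : Type) (r : seq I) (F : I -> nat -> R) :
  odd_expect n b (fun k => \sum_(i <- r) F i k) = \sum_(i <- r) odd_expect n b (F i).
Proof.
elim: r => [|i r IH].
  by rewrite big_nil -[RHS](odd_expect0 n b); apply: eq_odd_expect => k; rewrite big_nil.
rewrite big_cons -IH -odd_expectD; apply: eq_odd_expect => k; by rewrite big_cons.
Qed.

Hypothesis alpha01 : 0 < alpha < 1.

Lemma copy_prob_ge0 m : 0 <= copy_prob m.
Proof. by rewrite /copy_prob; case: ifP => // _; case/andP: alpha01 => /ltW. Qed.

Lemma copy_prob_le1 m : copy_prob m <= 1.
Proof. by rewrite /copy_prob; case: ifP => // _; case/andP: alpha01 => _ /ltW. Qed.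

Lemma copy_prob_div_ge0 m : 0 <= copy_prob m / m%:R.
Proof. by rewrite divr_ge0 ?ler0n ?copy_prob_ge0. Qed.

Lemma odd_expect_ge0 n b phi : (forall k, 0 <= phi k) -> 0 <= odd_expect n b phi.
Proof.
elim: n b phi => [|m IH] b phi phi0 //=; case: ifP => _; last exact: IH.
rewrite addr_ge0 // mulr_ge0 ?subr_ge0 ?copy_prob_le1 ?copy_prob_div_ge0 //.
  by apply: IH => k; exact: phi0.
by apply: sumr_ge0 => k _; exact: IH.
Qed.

Lemma odd_expect_le n b phi psi :
  (forall k, phi k <= psi k) -> odd_expect n b phi <= odd_expect n b psi.
Proof.
move=> le; rewrite -subr_ge0 -mulN1r addrC -odd_expect_lin.
by apply: odd_expect_ge0 => k; rewrite mulN1r addrC subr_ge0.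
Qed.

Lemma ler_norm_odd_expect n b phi :
  `|odd_expect n b phi| <= odd_expect n b (fun k => `|phi k|).
Proof.
rewrite ler_norml -mulN1r -odd_expectZ; apply/andP; split; apply: odd_expect_le => k.
  by rewrite mulN1r lerNl ler_normr lexx orbT.
exact: ler_norm.
Qed.

Definition odd_mean n b : R := odd_expect n b (fun k => k%:R).

Lemma odd_meanS n b : odd_mean n.+1 b =
  if b 0 then (1 - copy_prob n) * (odd_mean n (tailb b) + 1)
    + copy_prob n / n%:R * \sum_(k < n) odd_mean n (flipb (tailb b) k)
  else odd_mean n (tailb b).
Proof.
rewrite /odd_mean /=; case: ifP => // _; congr (_ * _ + _).
rewrite -[X in _ + X](odd_expect_const n (tailb b)) -odd_expectD.
by apply: eq_odd_expect => k; rewrite /= -natr1.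
Qed.

Lemma ler_norm_copy_prob_sum m (F : 'I_m -> R) (x : R) : (forall k, `|F k| <= x) ->
  `|copy_prob m / m%:R * \sum_(k < m) F k| <= copy_prob m * x.
Proof.
move=> le; have <- := @copy_prob_sum m (fun=> x) x (fun=> erefl).
rewrite normrM (ger0_norm (copy_prob_div_ge0 m)) ler_wpM2l ?copy_prob_div_ge0 //.
by apply: le_trans (ler_norm_sum _ _ _) (ler_sum _ _).
Qed.

Lemma flipbC b k l : flipb (flipb b k) l = flipb (flipb b l) k.
Proof. by apply/funext => j; rewrite /flipb addbAC. Qed.

(** Eliminating the items in the same way from two vectors of bits that differ
    in one place keeps them different in at most one place, and a difference in
    a fresh item changes the count by one. *)
Lemma odd_mean_flipb n b k : `|odd_mean n (flipb b k) - odd_mean n b| <= 1.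
Proof.
elim: n b k => [|n IH] b k; first by rewrite /odd_mean /= subrr normr0.
have r0 := copy_prob_ge0 n; have r1 := copy_prob_le1 n.
have key (b1 := tailb b) : `|(1 - copy_prob n) * (odd_mean n b1 + 1) + copy_prob n / n%:R *
    \sum_(k < n) odd_mean n (flipb b1 k) - odd_mean n b1| <= 1.
  have /ler_norm_copy_prob_sum :
      forall k : 'I_n, `|odd_mean n (flipb b1 k) - odd_mean n b1| <= 1 by [].
  rewrite sumrB mulrBr (@copy_prob_sum n (fun=> odd_mean n b1) (odd_mean n b1)) //.
  by rewrite !ler_norml => /andP[? ?]; apply/andP; split; nra.
rewrite !odd_meanS; case: k => [|k].
  have -> : tailb (flipb b 0) = tailb b.
    by apply/funext => j; rewrite /tailb /flipb addbF.
  rewrite {1}/flipb eqxx addbT; case: (b 0) => //=.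
  by rewrite distrC.
have -> : tailb (flipb b k.+1) = flipb (tailb b) k by [].
rewrite {1}/flipb /= addbF; case: (b 0) => //.
have /ler_norm_copy_prob_sum : forall l : 'I_n,
    `|odd_mean n (flipb (flipb (tailb b) k) l) - odd_mean n (flipb (tailb b) l)| <= 1.
  by move=> l; rewrite flipbC.
rewrite sumrB mulrBr; have := IH (tailb b) k.
rewrite !ler_norml => /andP[? ?] /andP[? ?]; apply/andP; split; nra.
Qed.

(** The variance of the count is at most [n]: by [odd_mean_flipb] the conditional
    means after removing one item lie within 1 of the mean for the remaining
    bits, so each item adds at most 1. Stating it around an arbitrary center [c]
    makes the induction go through. *)
Lemma odd_expect_sqr_le n b c :
  odd_expect n b (fun k => (k%:R - c) ^+ 2) <= n%:R + (odd_mean n b - c) ^+ 2.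
Proof.
elim: n b c => [|n IH] b c; first by rewrite /odd_mean /= lerDr.
have r0 := copy_prob_ge0 n; have r1 := copy_prob_le1 n.
rewrite odd_meanS /=; case: (b 0); last first.
  by apply: le_trans (IH _ _) _; rewrite -natr1; lra.
set a := odd_mean n (tailb b).
have -> : (fun k => (k%:R - c) ^+ 2) \o S
    = (fun k : nat => (k%:R - (c - 1)) ^+ 2) :> (nat -> R).
  by apply/funext => k /=; rewrite -natr1; congr (_ ^+ 2); ring.
have h1 := IH (tailb b) (c - 1); rewrite -/a in h1.
pose F k := odd_mean n (flipb (tailb b) k).
have h2 : copy_prob n / n%:R * \sum_(k < n) odd_expect n (flipb (tailb b) k)
     (fun k0 => (k0%:R - c) ^+ 2) <= copy_prob n / n%:R *
     \sum_(k < n) (n%:R + 1 - (a - c) ^+ 2 + 2 * (a - c) * (F k - c)).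
  rewrite ler_wpM2l ?copy_prob_div_ge0 //; apply: ler_sum => k _.
  apply: le_trans (IH _ _) _; rewrite -/(F k).
  have := odd_mean_flipb n (tailb b) k; rewrite -/a -/(F k) ler_norml => /andP[? ?].
  by nra.
pose X := copy_prob n / n%:R * \sum_(k < n) F k.
have E : copy_prob n / n%:R * \sum_(k < n) (n%:R + 1 - (a - c) ^+ 2
      + 2 * (a - c) * (F k - c))
    = copy_prob n * (n%:R + 1 - (a - c) ^+ 2) + 2 * (a - c) * (X - copy_prob n * c).
  rewrite big_split /= mulrDr.
  rewrite (@copy_prob_sum n _ (n%:R + 1 - (a - c) ^+ 2)) //; congr (_ + _).
  rewrite -mulr_sumr mulrCA; congr (_ * _); rewrite sumrB mulrBr; congr (_ - _).
  exact: copy_prob_sum.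
rewrite E in h2; rewrite -/X -natr1.
apply: le_trans (lerD (ler_wpM2l _ h1) h2) _; first by rewrite subr_ge0.
(* what is left is the square of the drift of the conditional mean *)
rewrite -subr_ge0.
rewrite [X in 0 <= X](_ : _ = ((1 - copy_prob n) * (a + 1) + X - a) ^+ 2) ?sqr_ge0 //.
ring.
Qed.

Lemma odd_expect_chebyshev n b s (A : pred nat) :
  0 < s -> (forall k, A k -> s <= `|k%:R - odd_mean n b|) ->
  odd_expect n b (fun k => (A k)%:R) <= n%:R / s ^+ 2.
Proof.
move=> s0 hA; rewrite ler_pdivlMr ?exprn_gt0 // mulrC -odd_expectZ.
apply: le_trans (_ : _ <= odd_expect n b (fun k => (k%:R - odd_mean n b) ^+ 2)) _.
  apply: odd_expect_le => k; case Ak: (A k); last by rewrite mulr0 sqr_ge0.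
  rewrite mulr1 -[leRHS]real_normK ?num_real //.
  by apply: lerXn2r (hA _ Ak); rewrite nnegrE ?normr_ge0 ?ltW.
by apply: le_trans (odd_expect_sqr_le _ _ _) _; rewrite subrr expr0n addr0.
Qed.
End Reinforcement.

(** * Sizes of the clusters of copies *)

Section Clusters.
Variables (R : realType) (alpha : R).
Hypothesis alpha01 : 0 < alpha < 1.
Let rf := copy_prob alpha.

(** Labelling the fresh item that follows [m] items by [m] makes the clusters
    the classes of items with equal label. *)
Definition label_expect (n : nat) (Phi : seq nat -> R) : R :=
  reinforced alpha 0%N (fun m f => f m) n Phi.

Lemma label_expectS m Phi : label_expect m.+1 Phi = label_expect m (fun c =>
  (1 - rf m) * Phi (m :: c) +
  rf m / m%:R * \sum_(k < m) Phi (nth 0%N c k :: c)).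
Proof. by []. Qed.

Lemma label_expect_lin n a Phi Psi :
  label_expect n (fun c => a * Phi c + Psi c)
  = a * label_expect n Phi + label_expect n Psi.
Proof. by apply: reinforced_lin. Qed.

Lemma label_expect0 n : label_expect n (fun=> 0) = 0.
Proof. by apply: reinforced0. Qed.

(** The process only reaches lists of [n] labels below [n]; the induction carries
    these two properties along because a copied position lies inside the list. *)
Lemma label_expect_ge0 n Phi :
  (forall c, size c = n -> all (ltn^~ n) c -> 0 <= Phi c) -> 0 <= label_expect n Phi.
Proof.
elim: n Phi => [|m IH] Phi Phi0; first exact: Phi0.
apply: IH => c sc /allP ac.
have ac' x : (x <= m)%N -> all (ltn^~ m.+1) (x :: c).
  move=> xm /=; rewrite ltnS xm; apply/allP => y /ac /=; exact: ltnW.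
rewrite addr_ge0 // mulr_ge0 ?subr_ge0 ?copy_prob_le1 ?copy_prob_div_ge0 //.
  by apply: Phi0; [rewrite /= sc | exact: ac'].
apply: sumr_ge0 => k _; apply: Phi0; first by rewrite /= sc.
by apply/ac'/ltnW/ac/mem_nth; rewrite sc.
Qed.

Lemma label_expect_le n Phi Psi :
  (forall c, size c = n -> all (ltn^~ n) c -> Phi c <= Psi c) ->
  label_expect n Phi <= label_expect n Psi.
Proof.
move=> le; rewrite -subr_ge0 -mulN1r addrC -label_expect_lin.
by apply: label_expect_ge0 => c sc ac; rewrite mulN1r addrC subr_ge0 le.
Qed.

Lemma eq_label_expect n Phi Psi :
  (forall c, size c = n -> all (ltn^~ n) c -> Phi c = Psi c) ->
  label_expect n Phi = label_expect n Psi.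
Proof.
move=> e; apply/eqP; rewrite eq_le.
by apply/andP; split; apply: label_expect_le => c sc ac; rewrite e.
Qed.

Lemma label_expect_const n x : label_expect n (fun=> x) = x.
Proof.
elim: n x => [|m IH] x //.
rewrite -[RHS]IH label_expectS; apply: eq_label_expect => c _ _.
by rewrite (@copy_prob_sum _ _ _ _ x) // mulrBl mul1r subrK.
Qed.

Lemma label_expect_sum n (I : Type) (r : seq I) (F : I -> seq nat -> R) :
  label_expect n (fun c => \sum_(i <- r) F i c) = \sum_(i <- r) label_expect n (F i).
Proof. by apply: reinforced_sum. Qed.

Lemma label_expect_sumZ n a (I : Type) (r : seq I) (F : I -> seq nat -> R) :
  label_expect n (fun c => a * \sum_(i <- r) F i c)
  = a * \sum_(i <- r) label_expect n (F i).
Proof. by rewrite -label_expect_sum; apply: reinforcedZ. Qed.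

(** The labels that do not start a cluster have count 0, so for [phi 0 = 0] this
    is the expected sum of [phi] over the sizes of the clusters. *)
Definition cluster_expect n (phi : nat -> R) : R :=
  label_expect n (fun c => \sum_(j < n) phi (count_mem (j : nat) c)).

Lemma cluster_expect_lin n a phi psi :
  cluster_expect n (fun N => a * phi N + psi N)
  = a * cluster_expect n phi + cluster_expect n psi.
Proof.
rewrite /cluster_expect -label_expect_lin; apply: eq_label_expect => c _ _.
by rewrite big_split /= mulr_sumr.
Qed.

Lemma cluster_expectZ n a phi :
  cluster_expect n (fun N => a * phi N) = a * cluster_expect n phi.
Proof.
rewrite -[RHS]addr0 -[X in _ + X](label_expect0 n) -label_expect_lin.
apply: eq_label_expect => c _ _; by rewrite addr0 mulr_sumr.
Qed.

Lemma cluster_expect_le n phi psi :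
  (forall N, phi N <= psi N) -> cluster_expect n phi <= cluster_expect n psi.
Proof. by move=> le; apply: label_expect_le => c _ _; apply: ler_sum => j _. Qed.

Lemma count_mem_out m (c : seq nat) : all (ltn^~ m) c -> count_mem m c = 0%N.
Proof.
move=> /allP ac; apply/count_memPn; apply/negP => /ac /=.
by rewrite ltnn.
Qed.

Lemma sum_eq_nth m (c : seq nat) (j : nat) : size c = m ->
  \sum_(k < m) (nth 0%N c k == j)%:R = (count_mem j c)%:R :> R.
Proof.
move=> <-; rewrite -(big_mkord xpredT (fun k => (nth 0%N c k == j)%:R)).
rewrite -(big_nth 0%N xpredT (fun x => (x == j)%:R : R)).
by rewrite -sum1_count natr_sum [RHS]big_mkcond /=; apply: eq_bigr => x _; case: eqP.
Qed.

(** The generator of the cluster sizes: a copy enlarges a cluster of size [N]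
    with probability [N / m]. *)
Lemma cluster_expectS m (phi : nat -> R) : phi 0 = 0 ->
  cluster_expect m.+1 phi = (1 - rf m) * phi 1 +
    cluster_expect m (fun N => phi N + rf m / m%:R * (N%:R * (phi N.+1 - phi N))).
Proof.
move=> phi0.
rewrite -(label_expect_const m ((1 - rf m) * phi 1)) -[X in X + _]mul1r -label_expect_lin.
rewrite /cluster_expect label_expectS; apply: eq_label_expect => c sc ac.
have N0 := count_mem_out ac.
rewrite !big_ord_recr /= eqxx N0 mul1r addn0.
have -> : \sum_(j < m) phi ((m == j) + count_mem (j : nat) c)%N
        = \sum_(j < m) phi (count_mem (j : nat) c).
  by apply: eq_bigr => j _; rewrite gtn_eqF.
have -> : \sum_(k < m) \sum_(j < m.+1)
      phi ((nth 0%N c k == j) + count_mem (j : nat) c)%N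
   = \sum_(k < m) \sum_(j < m) (phi (count_mem (j : nat) c)
       + (nth 0%N c k == j)%:R * (phi (count_mem (j : nat) c).+1
           - phi (count_mem (j : nat) c))).
  apply: eq_bigr => k _; rewrite big_ord_recr /= N0.
  have lt : (nth 0%N c k < m)%N by apply/(allP ac)/mem_nth; rewrite sc.
  rewrite (ltn_eqF lt) phi0 addr0; apply: eq_bigr => j _.
  by case: eqP => _; rewrite ?mul1r ?mul0r ?add1n ?add0n ?addr0 // addrC subrK.
rewrite exchange_big /=.
rewrite [X in _ + _ * X](eq_bigr (fun j : 'I_m => m%:R * phi (count_mem (j : nat) c)
   + (count_mem (j : nat) c)%:R * (phi (count_mem (j : nat) c).+1
           - phi (count_mem (j : nat) c)))); last first.
  move=> j _; rewrite big_split /= -mulr_suml sum_eq_nth //.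
  by rewrite sumr_const card_ord -[phi _ *+ m]mulr_natl.
rewrite !big_split /= -!mulr_sumr.
set A := \sum_(i < m) phi _; set B := \sum_(i < m) _ * _.
rewrite [copy_prob alpha m / m%:R * _]mulrDr.
have -> : copy_prob alpha m / m%:R * (m%:R * A) = rf m * A.
  rewrite /rf /copy_prob; case: (m) => [|k] /=; first by rewrite !mul0r.
  by rewrite mulrA divfK // pnatr_eq0.
by rewrite /rf; ring.
Qed.

(** For signs [s = (-1) ^ b] this counts the clusters whose bits have an odd sum;
    products of signs turn the addition of bits into a multiplication. *)
Definition cluster_sum (n : nat) (s : nat -> R) (c : seq nat) : R :=
  \sum_(j < n) 2^-1 * (1 - \prod_(k < n) (if nth 0%N c k == j then s k else 1)).

Lemma cluster_sum_cons m s x c : size c = m -> all (ltn^~ m) c ->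
  (x <= m)%N -> cluster_sum m.+1 s (x :: c) =
  (if x == m then 2^-1 * (1 - s 0) else 0) +
  \sum_(j < m) 2^-1 * (1 - (if x == j then s 0 else 1) *
     \prod_(k < m) (if nth 0%N c k == j then s k.+1 else 1)).
Proof.
move=> sc ac xm; rewrite /cluster_sum big_ord_recr /= addrC; congr (_ + _).
  rewrite big_ord_recl /= big1 ?mulr1 => [|k _].
    by case: eqP => // _; rewrite subrr mulr0.
  rewrite ltn_eqF //; apply/(allP ac)/mem_nth; by rewrite sc add0n.
by apply: eq_bigr => j _; rewrite big_ord_recl.
Qed.

(** Both sides satisfy the recursion that removes the newest item: copying
    position [k] multiplies the sign at [k] by the sign of the newest item. *)
Lemma odd_mean_labels n b :
  odd_mean alpha n b = label_expect n (cluster_sum n (fun k => (-1) ^+ b k)).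
Proof.
elim: n b => [|m IH] b; first by rewrite /odd_mean /label_expect /= /cluster_sum big_ord0.
pose s (b : nat -> bool) k : R := (-1) ^+ b k.
transitivity (label_expect m (fun c => (1 - rf m) *
   ((b 0%N)%:R + cluster_sum m (s (tailb b)) c) + rf m / m%:R * \sum_(k < m)
     cluster_sum m (s (if b 0%N then flipb (tailb b) k else tailb b)) c)).
  rewrite label_expect_lin label_expect_sumZ [X in label_expect _ X](_ : _ =
    (fun c => 1 * (b 0%N)%:R + cluster_sum m (s (tailb b)) c)); last first.
    by apply/funext => c; rewrite mul1r.
  rewrite label_expect_lin label_expect_const mul1r -IH odd_meanS.
  case: (b 0%N); last first.
    rewrite add0r (copy_prob_sum alpha (fun k => esym (IH (tailb b)))).
    by rewrite mulrBl mul1r subrK.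
  congr (_ * _ + _ * _); first by rewrite addrC.
  by apply: eq_bigr => k _; rewrite IH.
rewrite label_expectS; apply: eq_label_expect => c sc ac; congr (_ * _ + _ * _).
  rewrite cluster_sum_cons // eqxx; congr (_ + _).
    by case: (b 0%N); rewrite /= ?expr1 ?expr0; lra.
  by apply: eq_bigr => j _; rewrite gtn_eqF // mul1r.
apply: eq_bigr => k _; have lt : (nth 0%N c k < m)%N.
  by apply/(allP ac)/mem_nth; rewrite sc.
rewrite cluster_sum_cons // 1?ltnW // (ltn_eqF lt) add0r.
apply: eq_bigr => j _; congr (_ * (1 - _)).
rewrite (bigD1 k) //= [in RHS](bigD1 k) //= mulrA; congr (_ * _).
  rewrite /s /flipb; case: eqP => _; last by rewrite mulr1.
  rewrite /tailb; case: (b 0%N); rewrite ?eqxx ?addbT.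
    by case: (b k.+1); rewrite !(expr0, expr1) ?mulrN1 ?mulr1 ?opprK.
  by rewrite expr0 mul1r.
apply: eq_bigr => l lk; case: eqP => // _; rewrite /s /flipb.
by case: (b 0%N); rewrite // (_ : (l == k :> nat) = false) ?addbF //; apply/negbTE.
Qed.

Lemma prod_eq_nth m (c : seq nat) (j : nat) (x : R) : size c = m ->
  \prod_(k < m) (if nth 0%N c k == j then x else 1) = x ^+ count_mem j c.
Proof.
move=> <-; rewrite -(big_mkord xpredT (fun k => if nth 0%N c k == j then x else 1)).
rewrite -(big_nth 0%N xpredT (fun y => if y == j then x else 1)).
elim: c => [|y c IH]; first by rewrite big_nil.
by rewrite big_cons IH /=; case: eqP => _; rewrite ?mul1r // add1n exprS.
Qed.

Lemma odd_mean_cluster_expect n :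
  odd_mean alpha n (fun=> true) = cluster_expect n (fun N => 2^-1 * (1 - (-1) ^+ N)).
Proof.
rewrite odd_mean_labels; apply: eq_label_expect => c sc _; apply: eq_bigr => j _.
by rewrite expr1 prod_eq_nth.
Qed.
End Clusters.

(** * Tangent inequalities for powers *)

Section Tangents.
Variable R : realType.
Implicit Types a r x y s : R.

(** Bernoulli's inequality for exponents below 1 is the concavity of the
    logarithm at the barycenter [1 + a (y - 1)] of 1 and [y], which follows from
    [ln u <= u - 1]. *)
Lemma powR_le_tangent1 a y : 0 < a <= 1 -> 0 <= y -> y `^ a <= 1 + a * (y - 1).
Proof.
move=> /andP[a0 a1]; rewrite le_eqVlt => /predU1P[<-|y0].
  by rewrite powR0 ?gt_eqF //; lra.
have Z0 : 0 < 1 + a * (y - 1) by nra.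
have lnle u : 0 < u -> ln u <= u - 1 :> R.
  move=> u0; have := @le_ln1Dx R (u - 1).
  have -> : 1 + (u - 1) = u by ring.
  by apply; lra.
rewrite /powR gt_eqF // -[leRHS](@lnK R) // ler_expR.
set Z := 1 + _ in Z0 *.
have h1 := lnle _ (divr_gt0 y0 Z0).
have h2 := lnle _ (divr_gt0 ltr01 Z0).
rewrite ln_div ?posrE // in h1; rewrite ln_div ?posrE ?ltr01 // in h2.
rewrite ln1 in h2.
have E : a * (y / Z - 1) + (1 - a) * (1 / Z - 1) = 0.
  rewrite /Z; field; rewrite /= -/Z; exact: lt0r_neq0.
nra.
Qed.

(** The previous inequality for the exponent [1 / r]. *)
Lemma powR_ge_tangent1 r y : 1 <= r -> 0 <= y -> 1 + r * (y - 1) <= y `^ r.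
Proof.
move=> r1 y0; have r0 : 0 < r by lra.
have [Z0|Z0] := leP (1 + r * (y - 1)) 0; first exact: le_trans (powR_ge0 _ _).
have r01 : 0 < r^-1 <= 1 by rewrite invr_gt0 r0 invf_le1.
have := powR_le_tangent1 r01 (ltW Z0).
have -> : 1 + r^-1 * (1 + r * (y - 1) - 1) = y by field; exact: lt0r_neq0.
move=> /(ge0_ler_powR (ltW r0)); rewrite !nnegrE powR_ge0 y0 => /(_ isT isT).
by rewrite -powRrM mulVf ?gt_eqF // powRr1 // ltW.
Qed.

Lemma powR_scale r x y : 0 < x -> 0 <= y -> y `^ r = x `^ r * (y / x) `^ r.
Proof.
move=> x0 y0; have xge0 := ltW x0.
by rewrite -powRM ?divr_ge0 // mulrC divfK // gt_eqF.
Qed.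

Lemma powR_le_tangent a x y : 0 < a <= 1 -> 0 < x -> 0 <= y ->
  y `^ a <= x `^ a + a * (x `^ a / x) * (y - x).
Proof.
move=> a01 x0 y0; rewrite (powR_scale a x0 y0).
have /(powR_le_tangent1 a01) h : 0 <= y / x by rewrite divr_ge0 // ltW.
apply: le_trans (ler_wpM2l (powR_ge0 _ _) h) _.
rewrite le_eqVlt; apply/orP; left; apply/eqP; field; exact: lt0r_neq0.
Qed.

Lemma powR_ge_tangent r x y : 1 <= r -> 0 < x -> 0 <= y ->
  x `^ r + r * (x `^ r / x) * (y - x) <= y `^ r.
Proof.
move=> r1 x0 y0; rewrite (powR_scale r x0 y0).
have /(powR_ge_tangent1 r1) h : 0 <= y / x by rewrite divr_ge0 // ltW.
apply: le_trans _ (ler_wpM2l (powR_ge0 _ _) h).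
rewrite le_eqVlt; apply/orP; left; apply/eqP; field; exact: lt0r_neq0.
Qed.

Lemma powRS s x : 0 < x -> x `^ (s + 1) = x `^ s * x.
Proof.
move=> x0; rewrite powRD ?powRr1 ?ltW //.
by apply/implyP => _; exact: lt0r_neq0.
Qed.

(** By the two tangents at the ends of a unit interval, the increments of
    [x ^ (s + 1) / (s + 1)] lie between the values of [x ^ s] at these ends. *)
Lemma power_sum s n : 0 <= s ->
  n.+1%:R `^ (s + 1) / (s + 1) <= \sum_(j < n.+1) j.+1%:R `^ s
    <= n.+1%:R `^ (s + 1) / (s + 1) + n.+1%:R `^ s.
Proof.
move=> s0; have s1 : 1 <= s + 1 by lra.
have s1' : 0 < s + 1 by lra.
have pos m : 0 < m.+1%:R :> R by rewrite ltr0n.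
elim: n => [|n /andP[IH1 IH2]].
  rewrite big_ord_recl big_ord0 !powR1 addr0 div1r.
  by rewrite invf_le1 // s1 /= lerDr invr_ge0 ltW.
rewrite big_ord_recr /=.
have h1 := powR_ge_tangent s1 (pos n.+1) (ltW (pos n)).
have h2 := powR_ge_tangent s1 (pos n) (ltW (pos n.+1)).
rewrite (powRS _ (pos n.+1)) mulfK ?gt_eqF // -(powRS _ (pos n.+1)) in h1.
rewrite (powRS _ (pos n)) mulfK ?gt_eqF // -(powRS _ (pos n)) in h2.
have d1 : n.+1%:R - n.+2%:R = -1 :> R by rewrite -[n.+2%:R]natr1; lra.
have d2 : n.+2%:R - n.+1%:R = 1 :> R by rewrite -[n.+2%:R]natr1; lra.
rewrite d1 in h1; rewrite d2 in h2.
have h1' : n.+2%:R `^ (s + 1) / (s + 1) - n.+2%:R `^ s <= n.+1%:R `^ (s + 1) / (s + 1).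
  rewrite -[X in _ - X](@mulfK _ (s + 1)) ?gt_eqF // -mulrBl ler_pM2r ?invr_gt0 //.
  lra.
have h2' : n.+1%:R `^ (s + 1) / (s + 1) + n.+1%:R `^ s <= n.+2%:R `^ (s + 1) / (s + 1).
  rewrite -[X in _ + X](@mulfK _ (s + 1)) ?gt_eqF // -mulrDl ler_pM2r ?invr_gt0 //.
  lra.
by apply/andP; split; lra.
Qed.

Lemma riemann_power_sum s n : 0 <= s -> (0 < n)%N ->
  n%:R / (s + 1) <= \sum_(j < n) (j.+1%:R / n%:R) `^ s <= n%:R / (s + 1) + 1.
Proof.
case: n => // n s0 _; have n0 : 0 < n.+1%:R :> R by rewrite ltr0n.
have ns0 : 0 < n.+1%:R `^ s by exact: powR_gt0.
have -> : \sum_(j < n.+1) (j.+1%:R / n.+1%:R) `^ s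
        = (\sum_(j < n.+1) j.+1%:R `^ s) / n.+1%:R `^ s.
  rewrite mulr_suml; apply: eq_bigr => j _.
  by rewrite [in RHS](powR_scale s n0) // [RHS]mulrC mulKf // gt_eqF.
rewrite ler_pdivlMr // ler_pdivrMr // mulrDl mul1r.
by rewrite -mulrA [_^-1 * _]mulrC mulrA [n.+1%:R * _]mulrC -powRS // power_sum.
Qed.
End Tangents.

(** * The mean number of odd clusters *)

Section Mean.
Variables (R : realType) (alpha : R).
Hypothesis alpha01 : 0 < alpha < 1.

Lemma pow_taylor (x y : R) N : `|x| <= 1 -> `|y| <= 1 ->
  `|x ^+ N.+1 - y ^+ N.+1 - N.+1%:R * y ^+ N * (x - y)|
    <= N.+1%:R * N%:R * (x - y) ^+ 2.
Proof.
move=> x1 y1.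
have pow1 (z : R) k : `|z| <= 1 -> `|z ^+ k| <= 1.
  by move=> z1; rewrite normrX exprn_ile1.
have diff k : `|x ^+ k - y ^+ k| <= k%:R * `|x - y|.
  elim: k => [|k IH]; first by rewrite subrr normr0 mul0r.
  have -> : x ^+ k.+1 - y ^+ k.+1 = x * (x ^+ k - y ^+ k) + y ^+ k * (x - y).
    by rewrite !exprS; ring.
  apply: le_trans (ler_normD _ _) _; rewrite -natr1 mulrDl mul1r !normrM.
  apply: lerD; first by apply: le_trans IH; rewrite ler_piMl.
  by rewrite ler_piMl // pow1.
elim: N => [|N IH].
  by rewrite !expr1 expr0 mulr1 mul1r mulr0 mul0r subrr normr0.
have -> : x ^+ N.+2 - y ^+ N.+2 - N.+2%:R * y ^+ N.+1 * (x - y)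
  = x * (x ^+ N.+1 - y ^+ N.+1 - N.+1%:R * y ^+ N * (x - y))
    + N.+1%:R * y ^+ N * ((x - y) ^+ 2).
  by rewrite -[N.+2%:R]natr1 -[N.+1%:R]natr1 !exprS expr0; ring.
apply: le_trans (ler_normD _ _) _.
have h1 : `|x * (x ^+ N.+1 - y ^+ N.+1 - N.+1%:R * y ^+ N * (x - y))|
   <= N.+1%:R * N%:R * (x - y) ^+ 2.
  by rewrite normrM; apply: le_trans IH; rewrite ler_piMl.
have h2 : `|N.+1%:R * y ^+ N * ((x - y) ^+ 2)| <= N.+1%:R * (x - y) ^+ 2.
  rewrite normrM normrM normr_nat -mulrA ler_wpM2l ?ler0n //.
  by rewrite [`|(x - y) ^+ 2|]ger0_norm ?sqr_ge0 // ler_piMl ?sqr_ge0 ?pow1.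
apply: le_trans (lerD h1 h2) _; rewrite -mulrDl ler_wpM2r ?sqr_ge0 //.
by rewrite -!natrM -natrD ler_nat; lia.
Qed.

(** The indicator of an odd [N] when [w = -1]. *)
Definition oddness (w : R) (N : nat) : R := 2^-1 * (1 - w ^+ N).

(** The mean of [(-1) ^ N] for [N] geometric on the positive integers with
    parameter [p], the limit law of the size of a cluster. *)
Definition parity_base (p : R) : R := 1 - 2 / (2 - p).

Lemma oddness_parity_base1 p : p <= 1 -> oddness (parity_base p) 1 = (2 - p)^-1.
Proof. by move=> p1; rewrite /oddness /parity_base expr1; field; lra. Qed.

(** The function [w = parity_base p] solves the differential equation
    [p w' = w (1 - w)] that makes the terms of first order in [1 / M] cancel, if
    [p] grows like [M ^ alpha]; the hypotheses bound the increment of [p] in this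
    way. Second-order Taylor terms leave an error of order [N ^ 2 / M ^ 2]. *)
Lemma oddness_step (p p' M : R) N : 1 <= M -> 0 <= p -> p <= p' -> p' <= 1 ->
  alpha * p' / (M + 1) <= p' - p -> p' - p <= alpha * p / M ->
  `|oddness (parity_base p') N + alpha / M * (N%:R *
      (oddness (parity_base p') N.+1 - oddness (parity_base p') N))
    - oddness (parity_base p) N| <= 2 / M ^+ 2 * (N%:R * N.+1%:R).
Proof.
move=> M1 p0 pp' p'1 d1 d2; case/andP: alpha01 => a0 a1.
have M0 : 0 < M by lra.
case: N => [|N].
  by rewrite /oddness !expr0 !mul0r !mulr0 !subrr !mulr0 addr0 subrr normr0.
set w := parity_base p; set w' := parity_base p'; set d := p' - p in d1 d2.
have d0 : 0 <= d by rewrite /d; lra.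
have iM : 0 < M^-1 by rewrite invr_gt0.
have dM : d <= M^-1.
  by apply: le_trans d2 _; rewrite ler_piMl ?ltW //; nra.
have inv_le (q : R) : q <= 1 -> 0 < (2 - q)^-1 <= 1.
  by move=> q1; rewrite invr_gt0 invf_le1; [apply/andP; split; lra | lra].
have wn (q : R) : 0 <= q -> q <= 1 -> `|parity_base q| <= 1.
  move=> q0 q1; rewrite /parity_base ler_norml.
  have := inv_le _ q1; have : (2 - q) * (2 - q)^-1 = 1 by rewrite divff //; lra.
  by set i := (2 - q)^-1 => ? /andP[? ?]; apply/andP; split; nra.
have w1 : `|w| <= 1 by apply: wn => //; lra.
have w1' : `|w'| <= 1 by apply: wn => //; lra.
have /andP[i0 i1] := inv_le p (le_trans pp' p'1).
have /andP[i0' i1'] := inv_le p' p'1.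
have ww : w - w' = 2 * d * ((2 - p)^-1 * (2 - p')^-1).
  by rewrite /w /w' /parity_base /d; field; apply/andP; split; lra.
have ii : 0 <= (2 - p)^-1 * (2 - p')^-1 <= 1.
  have := ltW i0; have := ltW i0' => g1 g2.
  by rewrite mulr_ge0 //= mulr_ile1.
have sq : (w - w') ^+ 2 <= 4 / M ^+ 2.
  have : 0 <= w - w' <= 2 / M.
    rewrite ww; move: ii => /andP[? ?]; apply/andP; split; first by nra.
    by apply: le_trans (_ : _ <= 2 * d * 1) _; nra.
  have -> : 4 / M ^+ 2 = (2 / M) ^+ 2 by field; lra.
  by move=> /andP[? ?]; rewrite lerXn2r // nnegrE //; lra.
have lin : `|(w - w') + alpha / M * (w' * (1 - w'))| <= 4 / M ^+ 2.
  have -> : (w - w') + alpha / M * (w' * (1 - w')) =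
     2 * ((2 - p')^-1) ^+ 2 * (d - alpha * p' / M - d ^+ 2 * (2 - p)^-1).
    rewrite ww /w' /parity_base /d; field; apply/andP; split; [lra|].
    by apply/andP; split; lra.
  have e : `|d - alpha * p' / M - d ^+ 2 * (2 - p)^-1| <= 2 / M ^+ 2.
    have dd : 0 <= d ^+ 2 * (2 - p)^-1 <= 1 / M ^+ 2.
      apply/andP; split; first by rewrite mulr_ge0 ?sqr_ge0 // ltW.
      apply: le_trans (_ : _ <= d ^+ 2 * 1) _.
        by rewrite ler_wpM2l ?sqr_ge0.
      by rewrite mulr1 div1r -exprVn lerXn2r // nnegrE // ltW.
    have up : d <= alpha * p' / M.
      by apply: le_trans d2 _; apply/ler_wpM2r/ler_wpM2l => //; exact: ltW.
    have lo : alpha * p' / M - alpha * p' / (M + 1) <= 1 / M ^+ 2.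
      have -> : alpha * p' / M - alpha * p' / (M + 1) = alpha * p' * (M^-1 * (M + 1)^-1).
        by field; apply/andP; split; lra.
      rewrite div1r expr2 invfM; apply: le_trans (_ : _ <= 1 * (M^-1 * (M + 1)^-1)) _.
        apply: ler_wpM2r; last by nra.
        by rewrite mulr_ge0 ?invr_ge0 //; lra.
      rewrite mul1r; apply: ler_wpM2l; first exact: ltW.
      by rewrite lef_pV2 ?posrE; lra.
    have -> : 2 / M ^+ 2 = 1 / M ^+ 2 + 1 / M ^+ 2 by ring.
    by rewrite ler_norml; move: dd => /andP[? ?]; apply/andP; split; lra.
  rewrite normrM normrM (ger0_norm (_ : 0 <= 2)) // (@ger0_norm _ (_ ^+ 2)) ?sqr_ge0 //.
  have sq1 : ((2 - p')^-1) ^+ 2 <= 1 by rewrite exprn_ile1 // ltW.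
  have sq0 : 0 <= ((2 - p')^-1) ^+ 2 by exact: sqr_ge0.
  have -> : 4 / M ^+ 2 = 2 * 1 * (2 / M ^+ 2) by ring.
  by apply: ler_pM => //; [exact: mulr_ge0|rewrite ler_wpM2l].
have -> : oddness w' N.+1 + alpha / M * (N.+1%:R *
      (oddness w' N.+2 - oddness w' N.+1)) - oddness w N.+1
  = 2^-1 * ((w ^+ N.+1 - w' ^+ N.+1 - N.+1%:R * w' ^+ N * (w - w'))
     + N.+1%:R * w' ^+ N * ((w - w') + alpha / M * (w' * (1 - w')))).
  by rewrite /oddness !exprS; field; lra.
rewrite normrM ger0_norm ?invr_ge0 //.
have t1 := pow_taylor N w1 w1'.
have t2 : `|N.+1%:R * w' ^+ N * ((w - w') + alpha / M * (w' * (1 - w')))|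
    <= N.+1%:R * (4 / M ^+ 2).
  rewrite normrM normrM normr_nat -mulrA ler_wpM2l ?ler0n //.
  rewrite normrX -[leRHS]mul1r ler_pM // ?exprn_ge0 //.
  by rewrite exprn_ile1.
have t3 : N.+1%:R * N%:R * (w - w') ^+ 2 <= N.+1%:R * N%:R * (4 / M ^+ 2).
  by rewrite ler_wpM2l // mulr_ge0 ?ler0n.
have -> : 2 / M ^+ 2 * (N.+1%:R * N.+2%:R)
   = 2^-1 * (N.+1%:R * (N%:R + 2) * (4 / M ^+ 2)).
  by rewrite -[N.+2%:R]natr1 -[N.+1%:R]natr1; field; lra.
rewrite ler_wpM2l ?invr_ge0 //.
apply: le_trans (ler_normD _ _) _; apply: le_trans (lerD (le_trans t1 t3) t2) _.
rewrite -mulrDl ler_wpM2r ?divr_ge0 ?sqr_ge0 //.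
by rewrite -natr1; have : 0 <= N%:R :> R by []; nra.
Qed.

(** The generator multiplies [N (N + 1)] by [1 + 2 alpha / m], so the growth is
    at most that of [m ^ (1 + alpha)], because [2 alpha < 1 + alpha]. *)
Lemma cluster_second_moment m : (0 < m)%N ->
  cluster_expect alpha m (fun N => N%:R * N.+1%:R) <= 2 * m%:R `^ (1 + alpha).
Proof.
case/andP: alpha01 => a0 a1.
case: m => // m _; elim: m => [|m IH].
  rewrite (cluster_expectS alpha01) ?mul0r // powR1 mulr1 /copy_prob /=.
  by rewrite /cluster_expect /label_expect /= big_ord0; lra.
rewrite (cluster_expectS alpha01) ?mul0r //= mul1r.
have -> : (fun N => N%:R * N.+1%:R + copy_prob alpha m.+1 / m.+1%:R *
      (N%:R * (N.+1%:R * N.+2%:R - N%:R * N.+1%:R)))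
    = (fun N : nat => (1 + 2 * alpha / m.+1%:R) * (N%:R * N.+1%:R)) :> (nat -> R).
  apply/funext => N; rewrite /copy_prob /=.
  by rewrite -[N.+2%:R]natr1 -[N.+1%:R]natr1; ring.
rewrite (cluster_expectZ alpha01); set q := cluster_expect _ _ _ in IH *.
set M := m.+1%:R in IH *; have M1 : 1 <= M by rewrite /M ler1n.
have M0 : 0 < M by lra.
have := @powR_ge_tangent R (1 + alpha) M m.+2%:R _ M0 (ler0n _ _).
have -> : m.+2%:R - M = 1 by rewrite /M -[m.+2%:R]natr1; ring.
rewrite mulr1 [1 + alpha]addrC powRS // mulfK ?gt_eqF // in IH *.
move=> /(_ (ltac:(lra))) h.
have Ma : 1 <= M `^ alpha.
  have e1 : 1 `^ alpha = 1 :> R by rewrite powR1.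
  by rewrite -e1; apply: ge0_ler_powR; rewrite ?nnegrE; lra.
have h2 : (1 + 2 * alpha / M) * q <= (1 + 2 * alpha / M) * (2 * (M `^ alpha * M)).
  by rewrite ler_wpM2l // addr_ge0 // divr_ge0 ?mulr_ge0 // ltW.
have E : (1 + 2 * alpha / M) * (2 * (M `^ alpha * M))
    = 2 * (M `^ alpha * M) + 4 * alpha * M `^ alpha by field; lra.
rewrite E in h2; rewrite /copy_prob /=.
have k : (1 - alpha) * 1 <= (1 - alpha) * M `^ alpha.
  by rewrite ler_wpM2l // subr_ge0 ltW.
apply: le_trans (lerD (lexx _) h2) _; lra.
Qed.

(** The parameter of the approximately geometric size, at time [n], of a cluster
    born at time [m]. *)
Definition geom_param (n m : nat) : R := (m%:R / n%:R) `^ alpha.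

Lemma geom_param_bounds n m : (0 < m < n)%N ->
  [/\ 0 <= geom_param n m, geom_param n m <= geom_param n m.+1,
      geom_param n m.+1 <= 1,
      alpha * geom_param n m.+1 / (m%:R + 1) <= geom_param n m.+1 - geom_param n m &
      geom_param n m.+1 - geom_param n m <= alpha * geom_param n m / m%:R].
Proof.
case/andP: alpha01 => a0 a1 /andP[m0 mn].
have n0 : 0 < n%:R :> R by rewrite ltr0n (leq_trans _ mn).
have m0R : 0 < m%:R :> R by rewrite ltr0n.
have x0 : 0 < m%:R / n%:R :> R by rewrite divr_gt0.
have y0 : 0 < m.+1%:R / n%:R :> R by rewrite divr_gt0 // ltr0n.
have a01 : 0 < alpha <= 1 by rewrite a0 ltW.
have dxy : m.+1%:R / n%:R - m%:R / n%:R = n%:R^-1 :> R.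
  by rewrite -mulrBl -natr1 addrC addKr mul1r.
have h1 := powR_le_tangent a01 x0 (ltW y0).
have h2 := powR_le_tangent a01 y0 (ltW x0).
rewrite dxy in h1; rewrite -[X in _ <= _ + _ * X]opprB dxy in h2.
rewrite -/(geom_param n m) -/(geom_param n m.+1) in h1 h2; rewrite mulrN in h2.
split.
- exact: powR_ge0.
- apply: ge0_ler_powR; rewrite ?nnegrE; [exact: ltW| exact: ltW| exact: ltW|].
  by rewrite ler_pM2r ?invr_gt0 // ler_nat.
- have e1 : 1 `^ alpha = 1 :> R by rewrite powR1.
  rewrite -[leRHS]e1; apply: ge0_ler_powR; rewrite ?nnegrE ?(ltW a0) ?(ltW y0) //.
  by rewrite ler_pdivrMr // mul1r ler_nat.
- have : alpha * geom_param n m.+1 / (m%:R + 1) =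
      alpha * (geom_param n m.+1 / (m.+1%:R / n%:R)) * n%:R^-1.
    rewrite -natr1; field; apply/andP; split; first exact: lt0r_neq0.
    by rewrite natr1 pnatr_eq0.
  by move=> ->; move: h2; set X := alpha * _ * _; lra.
- have : alpha * geom_param n m / m%:R = alpha * (geom_param n m / (m%:R / n%:R)) * n%:R^-1.
    by field; apply/andP; split; exact: lt0r_neq0.
  by move=> ->; move: h1; set X := alpha * _ * _; lra.
Qed.

(** Up to the errors of [oddness_step], going from time [m] to [m + 1] adds only
    the contribution [1 / (2 - geom_param n m.+1)] of a possible new cluster. The
    errors are bounded by the increments of [8 / alpha * m ^ alpha]. *)
Lemma cluster_expect_oddness n m : (0 < m <= n)%N ->
  `|cluster_expect alpha m (oddness (parity_base (geom_param n m)))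
     - (1 - alpha) * \sum_(j < m) (2 - geom_param n j.+1)^-1|
  <= 1 + 8 / alpha * m%:R `^ alpha.
Proof.
case/andP: alpha01 => a0 a1.
have odd0 w : oddness w 0 = 0 by rewrite /oddness expr0 subrr mulr0.
have ia0 : 0 < alpha^-1 by rewrite invr_gt0.
case: m => // m /andP[_]; elim: m => [|m IH] mn.
  rewrite (cluster_expectS alpha01) //= big_ord1 /copy_prob /=
    /cluster_expect /label_expect /= big_ord0.
  rewrite subr0 mul1r addr0.
  have p1 : geom_param n 1 <= 1.
    have e1 : 1 `^ alpha = 1 :> R by rewrite powR1.
    have n0 : 0 < n%:R :> R by rewrite ltr0n.
    rewrite -[leRHS]e1; apply: ge0_ler_powR; rewrite ?nnegrE ?(ltW a0) //.
    by rewrite ler_pdivrMr // mul1r ler_nat.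
  rewrite oddness_parity_base1 // powR1 mulr1.
  have -> : (2 - geom_param n 1)^-1 - (1 - alpha) * (2 - geom_param n 1)^-1
     = alpha * (2 - geom_param n 1)^-1 by ring.
  have h0 : 0 < (2 - geom_param n 1)^-1 by rewrite invr_gt0; lra.
  have h1 : (2 - geom_param n 1)^-1 <= 1 by rewrite invf_le1; lra.
  by rewrite ger0_norm; nra.
have mn' : (0 < m.+1 < n)%N by [].
have [p0 pp p1 d1 d2] := geom_param_bounds mn'.
rewrite (cluster_expectS alpha01) // big_ord_recr /= oddness_parity_base1 //.
have {}IH := IH (ltnW mn).
set M := m.+1%:R in d1 d2 IH *; have M1 : 1 <= M by rewrite /M ler1n.
have M0 : 0 < M by lra.
set w := parity_base (geom_param n m.+1) in IH *; set w' := parity_base (geom_param n m.+2).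
have step N := @oddness_step _ _ M N M1 p0 pp p1 d1 d2.
have := cluster_second_moment (ltn0Sn m); rewrite -/M [1 + alpha]addrC powRS // => q2.
pose h N : R := 2 / M ^+ 2 * (N%:R * N.+1%:R).
have eh : cluster_expect alpha m.+1 h <= 4 * (M `^ alpha / M).
  rewrite /h (cluster_expectZ alpha01); apply: le_trans (ler_wpM2l _ q2) _.
    by rewrite divr_ge0 ?sqr_ge0.
  by rewrite le_eqVlt; apply/orP; left; apply/eqP; field; lra.
set L := fun N : nat => oddness w' N + _.
have st N : `|L N - oddness w N| <= h N by exact: step.
have diff : `|cluster_expect alpha m.+1 L - cluster_expect alpha m.+1 (oddness w)|
    <= cluster_expect alpha m.+1 h.
  rewrite ler_norml; apply/andP; split.
    rewrite lerNl opprB lerBlDr -[X in X + _]mul1r -(cluster_expect_lin alpha01).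
    apply: (cluster_expect_le alpha01) => N; have := st N.
    by rewrite mul1r ler_norml => /andP[? _]; lra.
  rewrite lerBlDr -[X in X + _]mul1r -(cluster_expect_lin alpha01).
  apply: (cluster_expect_le alpha01) => N; have := st N.
  by rewrite mul1r ler_norml => /andP[_ ?]; lra.
have a01 : 0 < alpha <= 1 by rewrite a0 ltW.
have N0 : 0 < m.+2%:R :> R by rewrite ltr0n.
have tg := powR_le_tangent a01 N0 (ltW M0).
have dM : M - m.+2%:R = -1 by rewrite /M -[m.+2%:R]natr1; ring.
rewrite dM in tg.
have cmp : M `^ alpha / M <= 2 * (m.+2%:R `^ alpha / m.+2%:R).
  have MM : M `^ alpha <= m.+2%:R `^ alpha.
    by apply: ge0_ler_powR; rewrite ?nnegrE ?(ltW a0) ?ler_nat // ltW.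
  have iM : M^-1 <= 2 * m.+2%:R^-1.
    rewrite ler_pdivlMr // mulrC ler_pdivrMr // -[m.+2%:R]natr1 -/M; lra.
  rewrite mulrCA; apply: ler_pM => //; first exact: powR_ge0.
  by rewrite invr_ge0 ltW.
have X0 : 0 <= m.+2%:R `^ alpha / m.+2%:R by rewrite divr_ge0 ?powR_ge0 ?ltW.
set X := m.+2%:R `^ alpha / _ in cmp tg X0.
have tot : 8 / alpha * M `^ alpha + 4 * (M `^ alpha / M) <= 8 / alpha * m.+2%:R `^ alpha.
  have : 8 / alpha * M `^ alpha <= 8 / alpha * (m.+2%:R `^ alpha + alpha * X * -1).
    by rewrite ler_wpM2l // divr_ge0 // ltW.
  have -> : 8 / alpha * (m.+2%:R `^ alpha + alpha * X * -1)
     = 8 / alpha * m.+2%:R `^ alpha - 8 * X by field; lra.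
  set u := 8 / alpha * _; set v := 8 / alpha * _; set Y := M `^ alpha / M in cmp *.
  by lra.
rewrite /copy_prob /=.
have dd := le_trans diff eh.
move: dd IH tot; set u := 8 / alpha * _; set v := 8 / alpha * _.
set Y := 4 * _; set T := (2 - _)^-1; set Sg := \sum_(j < m.+1) _.
by rewrite !ler_norml => /andP[? ?] /andP[? ?] ?; apply/andP; split; lra.
Qed.

Lemma odd_mean_riemann n : (0 < n)%N ->
  `|odd_mean alpha n (fun=> true)
     - (1 - alpha) * \sum_(j < n) (2 - (j.+1%:R / n%:R) `^ alpha)^-1|
  <= 1 + 8 / alpha * n%:R `^ alpha.
Proof.
move=> n0; have := @cluster_expect_oddness n n; rewrite n0 leqnn => /(_ isT).
have geom_paramE : geom_param n n = 1 by rewrite /geom_param divff ?powR1 // pnatr_eq0 -lt0n.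
have oddE : oddness (parity_base (geom_param n n)) = (fun N => 2^-1 * (1 - (-1) ^+ N)).
  rewrite geom_paramE; apply/funext => N; rewrite /oddness /parity_base.
  by congr (_ * (1 - _ ^+ _)); field.
by rewrite oddE -(odd_mean_cluster_expect alpha01).
Qed.

Local Open Scope classical_set_scope.
Local Open Scope ring_scope.

(** The quotient of the Pochhammer symbols of [1 / alpha] and [1 / alpha + 1]
    telescopes to [1 / (alpha m + 1)]. *)
Lemma hyp_term (z : R) m :
  pochhammer 1 m * pochhammer alpha^-1 m / pochhammer (alpha^-1 + 1) m
    * (z ^+ m / m`!%:R) = z ^+ m / (alpha * m%:R + 1).
Proof.
case/andP: alpha01 => a0 a1; have ia0 : 0 < alpha^-1 by rewrite invr_gt0.
have pos k : 0 < alpha^-1 + k%:R by rewrite ltr_wpDr.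
have fac : pochhammer 1 m = m`!%:R :> R.
  elim: m => [|m IH]; first by rewrite /pochhammer big_nil.
  by rewrite /pochhammer big_nat_recr //= -/(pochhammer 1 m) IH factS natrM mulrC nat1r.
have poch0 k : 0 < pochhammer alpha^-1 k.
  by apply: prodr_gt0 => i _; exact: pos.
have rat : pochhammer (alpha^-1 + 1) m
    = pochhammer alpha^-1 m * (alpha * m%:R + 1).
  elim: m {fac} => [|m IH]; first by rewrite /pochhammer !big_nil mulr0 add0r mulr1.
  rewrite /pochhammer !big_nat_recr //= -/(pochhammer _ m) IH -/(pochhammer _ m).
  by rewrite -natr1; field; lra.
have q0 : 0 < alpha * m%:R + 1 by rewrite ltr_wpDl // mulr_ge0 // ltW.
rewrite fac rat; field; rewrite !lt0r_neq0 //= pnatr_eq0 -lt0n.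
Qed.

Local Notation F := (hyp2F1 1 alpha^-1 (alpha^-1 + 1) 2^-1 : R).
Let t (k : nat) : R := 2^-1 ^+ k / (alpha * k%:R + 1).

Let t_bound k : 0 <= t k <= 2^-1 ^+ k.
Proof.
case/andP: alpha01 => a0 a1.
have q1 : 1 <= alpha * k%:R + 1 by rewrite lerDr mulr_ge0 // ltW.
have q0 : 0 < alpha * k%:R + 1 by lra.
have h0 : 0 <= 2^-1 ^+ k :> R by rewrite exprn_ge0 // invr_ge0.
rewrite /t divr_ge0 ?(ltW q0) //= ler_pdivrMr //.
by rewrite ler_peMr.
Qed.

Lemma hyp_cvg : series t @ \oo --> F.
Proof.
have -> : F = limn (series t).
  by rewrite /hyp2F1; congr (limn (series _)); apply/funext => m; rewrite hyp_term.
apply: (@series_le_cvg R t (geometric 1 2^-1)).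
- by move=> k; case/andP: (t_bound k).
- by move=> k; rewrite /= mul1r exprn_ge0 // invr_ge0.
- by move=> k; rewrite /= mul1r; case/andP: (t_bound k).
- apply: is_cvg_geometric_series; rewrite ger0_norm ?invr_ge0 //; lra.
Qed.

Lemma geometric_expansion (p : R) M : p <= 1 ->
  (2 - p)^-1 = \sum_(0 <= k < M) 2^-1 ^+ k.+1 * p ^+ k
    + (p / 2) ^+ M * (2 - p)^-1.
Proof.
move=> p1; elim: M => [|M IH]; first by rewrite big_nil add0r expr0 mul1r.
rewrite big_nat_recr //= [LHS]IH; set S := \sum_(0 <= k < M) _.
rewrite !exprMn !exprS; field; lra.
Qed.

(** The [k]-th term of the geometric series is a power sum with exponent
    [alpha * k], which differs from [n / (alpha k + 1)] by at most 1; these errors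
    have total weight at most 1. *)
Lemma riemann_partial n M : (0 < n)%N ->
  `|\sum_(j < n) (2 - (j.+1%:R / n%:R) `^ alpha)^-1 - n%:R / 2 * series t M|
  <= 1 + n%:R * 2^-1 ^+ M.
Proof.
move=> n0; case/andP: alpha01 => a0 a1.
have nR : 0 < n%:R :> R by rewrite ltr0n.
pose p (j : 'I_n) : R := (j.+1%:R / n%:R) `^ alpha.
have p0 j : 0 <= p j by exact: powR_ge0.
have p1 j : p j <= 1.
  have e1 : 1 `^ alpha = 1 :> R by rewrite powR1.
  rewrite -[leRHS]e1; apply: ge0_ler_powR; rewrite ?nnegrE ?(ltW a0) //.
  by rewrite ler_pdivrMr // mul1r ler_nat.
have h0 k : 0 <= 2^-1 ^+ k :> R by rewrite exprn_ge0 // invr_ge0.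
have -> : \sum_(j < n) (2 - (j.+1%:R / n%:R) `^ alpha)^-1 =
    \sum_(0 <= k < M) 2^-1 ^+ k.+1 * \sum_(j < n) p j ^+ k
    + \sum_(j < n) (p j / 2) ^+ M * (2 - p j)^-1.
  under eq_bigr => j _ do rewrite -/(p j) (geometric_expansion M (p1 j)).
  rewrite big_split /= exchange_big /=; congr (_ + _).
  by apply: eq_bigr => k _; rewrite mulr_sumr.
have rem : 0 <= \sum_(j < n) (p j / 2) ^+ M * (2 - p j)^-1 <= n%:R * 2^-1 ^+ M.
  apply/andP; split.
    apply: sumr_ge0 => j _; rewrite mulr_ge0 ?exprn_ge0 ?divr_ge0 ?invr_ge0 //.
    by have := p1 j; lra.
  have -> : n%:R * 2^-1 ^+ M = \sum_(j < n) 2^-1 ^+ M :> R.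
    by rewrite sumr_const card_ord mulr_natl.
  apply: ler_sum => j _; rewrite -[leRHS]mulr1; apply: ler_pM.
  - by rewrite exprn_ge0 // divr_ge0.
  - by rewrite invr_ge0; have pj := p1 j; lra.
  - rewrite exprMn ler_piMl //; exact: exprn_ile1.
  - by have pj := p1 j; rewrite invf_le1; lra.
have term k : 2^-1 ^+ k.+1 * (n%:R / (alpha * k%:R + 1)) <= 2^-1 ^+ k.+1 *
    \sum_(j < n) p j ^+ k <= 2^-1 ^+ k.+1 * (n%:R / (alpha * k%:R + 1)) + 2^-1 ^+ k.+1.
  have s0 : 0 <= alpha * k%:R by rewrite mulr_ge0 // ltW.
  have := riemann_power_sum s0 n0.
  have -> : \sum_(j < n) (j.+1%:R / n%:R) `^ (alpha * k%:R) = \sum_(j < n) p j ^+ k.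
    by apply: eq_bigr => j _; rewrite powRrM powR_mulrn.
  move=> /andP[l1 l2]; rewrite ler_wpM2l //=.
  by apply: le_trans (ler_wpM2l (h0 _) l2) _; rewrite mulrDr mulr1.
have eqS : n%:R / 2 * series t M
   = \sum_(0 <= k < M) 2^-1 ^+ k.+1 * (n%:R / (alpha * k%:R + 1)).
  rewrite /series /= mulr_sumr; apply: eq_bigr => k _; rewrite /t exprS; ring.
have geo : \sum_(0 <= k < M) 2^-1 ^+ k.+1 <= 1 :> R.
  suff -> : \sum_(0 <= k < M) 2^-1 ^+ k.+1 = 1 - 2^-1 ^+ M :> R.
    by rewrite lerBlDr lerDl.
  elim: M {rem eqS} => [|M IH]; first by rewrite big_nil expr0 subrr.
  by rewrite big_nat_recr //= IH exprS; lra.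
have lo : n%:R / 2 * series t M <= \sum_(0 <= k < M) 2^-1 ^+ k.+1 * \sum_(j < n) p j ^+ k.
  by rewrite eqS; apply: ler_sum => k _; case/andP: (term k).
have hi : \sum_(0 <= k < M) 2^-1 ^+ k.+1 * \sum_(j < n) p j ^+ k
   <= n%:R / 2 * series t M + 1.
  rewrite eqS; apply: le_trans (lerD (lexx _) geo); rewrite -big_split /=.
  by apply: ler_sum => k _; case/andP: (term k).
move: rem lo hi; set A := \sum_(0 <= k < M) _; set B := \sum_(j < n) _.
set C := _ * series t M; set D := n%:R * _ => /andP[? ?] ? ?.
by rewrite ler_norml; apply/andP; split; lra.
Qed.

Lemma riemann_hyp n : (0 < n)%N ->
  `|\sum_(j < n) (2 - (j.+1%:R / n%:R) `^ alpha)^-1 - n%:R / 2 * F| <= 1.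
Proof.
move=> n0; set A := \sum_(j < n) _.
have c1 : (fun M => `|A - n%:R / 2 * series t M|) @ \oo --> `|A - n%:R / 2 * F|.
  apply: cvg_norm; apply: cvgB; first exact: cvg_cst.
  by apply: cvgM; [exact: cvg_cst | exact: hyp_cvg].
have c2 : (fun M => 1 + n%:R * 2^-1 ^+ M : R) @ \oo --> (1 + n%:R * 0 : R).
  apply: cvgD; first exact: cvg_cst.
  apply: cvgM; first exact: cvg_cst.
  apply: cvg_expr; rewrite ger0_norm ?invr_ge0 //; lra.
rewrite -[leRHS]addr0 -(mulr0 n%:R) -(cvg_lim _ c1) // -(cvg_lim _ c2) //.
apply: ler_lim.
- by apply/cvg_ex; eexists; exact: c1.
- by apply/cvg_ex; eexists; exact: c2.
- by apply: nearW => M; exact: riemann_partial.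
Qed.

Lemma odd_mean_asymptotics n : (0 < n)%N ->
  `|odd_mean alpha n (fun=> true) - (1 - alpha) * F / 2 * n%:R|
  <= 2 + 8 / alpha * n%:R `^ alpha.
Proof.
move=> n0; have := odd_mean_riemann n0; have := riemann_hyp n0.
case/andP: alpha01 => a0 a1.
set A := \sum_(j < n) _; set m := odd_mean _ _ _; set B := 8 / alpha * _.
rewrite !ler_norml => /andP[h1 h2] /andP[h3 h4].
have h1' : (1 - alpha) * (A - n%:R / 2 * F) <= (1 - alpha) * 1.
  by apply: ler_wpM2l => //; lra.
have h2' : (1 - alpha) * (- 1) <= (1 - alpha) * (A - n%:R / 2 * F).
  by apply: ler_wpM2l => //; lra.
by apply/andP; split; lra.
Qed.

(** A bound that keeps the denominator of the mixing time away from 0. *)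
Lemma hyp_ge1 : 1 <= F.
Proof.
rewrite -(cvg_lim _ hyp_cvg) //; apply: limr_ge.
  by apply/cvg_ex; eexists; exact: hyp_cvg.
near=> M.
have M0 : (0 < M)%N by near: M; exact: nbhs_infty_gt.
rewrite /series /= -(prednK M0) big_nat_recl //= /t expr0 mulr0 add0r divr1 lerDl.
by apply: sumr_ge0 => k _; case/andP: (t_bound k.+1).
Unshelve. all: by end_near.
Qed.
End Mean.

(** * The law of the increments *)

Section Partition.
Local Open Scope classical_set_scope.
Local Open Scope ring_scope.
Variables (R : realType) (disp : measure_display) (T : measurableType disp)
  (P : probability T R).

Lemma measure_partition (V : finType) (Z : T -> V) (A : set T) (q : V -> R) :
  (forall v, measurable (A `&` [set w | Z w = v])) ->
  (forall v, P (A `&` [set w | Z w = v]) = (q v)%:E) ->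
  measurable A /\ P A = (\sum_v q v)%:E.
Proof.
move=> mA PA.
have step (r : seq V) : uniq r ->
    measurable (A `&` [set w | Z w \in r]) /\
    P (A `&` [set w | Z w \in r]) = (\sum_(v <- r) q v)%:E.
  elim: r => [_|v r IH /= /andP[vr ur]].
    have -> : A `&` [set w | Z w \in [::]] = set0.
      by apply/seteqP; split => w // [].
    by rewrite measure0 big_nil.
  have [m1 e1] := IH ur.
  have -> : A `&` [set w | Z w \in v :: r]
      = (A `&` [set w | Z w = v]) `|` (A `&` [set w | Z w \in r]).
    apply/seteqP; split => w /=.
      by move=> [Aw]; rewrite inE => /orP[/eqP ->|zr]; [left|right].
    by move=> [[Aw zv]|[Aw zr]]; split => //; rewrite inE ?zv ?eqxx ?zr ?orbT.
  split; first exact: measurableU.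
  rewrite measureU; [by rewrite big_cons EFinD -e1 -PA|exact: mA|exact: m1|].
  apply/seteqP; split => w //= [[_ zv] [_ zr]].
  by move: vr; rewrite -zv zr.
have := step (enum V) (enum_uniq V).
have -> : A `&` [set w | Z w \in enum V] = A.
  by apply/seteqP; split => w /=; [case|move=> Aw; split => //; rewrite mem_enum].
by rewrite big_enum.
Qed.
End Partition.

Section History.
Local Open Scope classical_set_scope.
Local Open Scope ring_scope.
Variables (R : realType) (disp : measure_display) (T : measurableType disp)
  (P : probability T R) (G : finGroupType) (mu : G -> R) (alpha : R)
  (xi : nat -> T -> bool) (u : nat -> T -> nat) (Y : nat -> T -> G)
  (X S : nat -> T -> G).
Hypothesis H : srrw_construction P mu alpha xi u Y X S.

Fixpoint hist (n : nat) (w : T) : seq G :=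
  if n is m.+1 then X m.+1 w :: hist m w else [::].

Lemma nth_hist m k w : (k < m)%N -> nth 1%g (hist m w) k = X (m - k) w.
Proof.
elim: m k => // m IH [|k] km /=; first by rewrite subn0.
by rewrite IH // subSS.
Qed.

Definition fresh_step (m : nat) (f : G -> R) : R := \sum_(g : G) mu g * f g.

Lemma fresh_step_lin m a f g :
  fresh_step m (fun y => a * f y + g y) = a * fresh_step m f + fresh_step m g.
Proof.
rewrite /fresh_step mulr_sumr -big_split /=; apply: eq_bigr => y _; ring.
Qed.

Let src := source xi u Y.
Let pr (i : nat + nat + nat) (v : source_type G i) : R :=
  fine (P [set w | src i w = v]).
Let block (s : seq (nat + nat + nat)) (x : forall i, source_type G i) : set T :=
  [set w | forall i, i \in s -> src i w = x i].

Let m_src i v : measurable [set w | src i w = v].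
Proof.
case: i v => [[k|k]|k] v.
- exact: (srrw_xi_rv H).
- exact: (srrw_u_rv H).
- exact: (srrw_Y_rv H).
Qed.

Let block_cons i s x : block (i :: s) x = [set w | src i w = x i] `&` block s x.
Proof.
apply/seteqP; split => w /=.
  move=> h; split; first by apply: h; rewrite mem_head.
  by move=> j js; apply: h; rewrite inE js orbT.
by move=> [h1 h2] j; rewrite inE => /orP[/eqP ->//|]; exact: h2.
Qed.

Let m_block s x : measurable (block s x).
Proof.
elim: s => [|i s IH]; last by rewrite block_cons; exact: measurableI.
have -> : block [::] x = setT by apply/seteqP; split.
exact: measurableT.
Qed.

Let P_block s x : uniq s -> P (block s x) = (\prod_(i <- s) pr (x i))%:E.
Proof.
move=> us; rewrite (srrw_indep H x us).
elim: s {us} => [|i s IH]; first by rewrite !big_nil.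
rewrite !big_cons IH EFinM fineK // fin_num_measure //; exact: m_src.
Qed.

(** The sources that are not read during the first [n] steps. *)
Definition future (n : nat) (i : nat + nat + nat) : bool :=
  match i with
  | inl (inl k) => n < k.+2
  | inl (inr k) => n < k.+2
  | inr k => n < k.+1
  end%N.

Let prob_Y k v : P [set w | Y k.+1 w = v] = (mu v)%:E.
Proof. exact: (srrw_Y_law H). Qed.

Lemma sum_step_mass : \sum_g mu g = 1.
Proof.
have [||_] := @measure_partition _ _ _ P G (Y 1) setT mu.
- by move=> v; rewrite setTI; exact: (srrw_Y_rv H).
- by move=> v; rewrite setTI prob_Y.
by rewrite probability_setT => -[].
Qed.

Let E n (Phi : pred (seq G)) : R :=
  reinforced alpha 1%g fresh_step n (fun c => (Phi c)%:R).

(** Carrying along a finite set of future sources makes the statement inductive: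
    a step of the walk is a choice of the values of three more sources, each of
    which leaves an event about the history that is shorter by one. *)
Lemma hist_law_future n (Phi : pred (seq G)) s x :
  uniq s -> all (future n) s ->
  measurable ([set w | Phi (hist n w)] `&` block s x) /\
  P ([set w | Phi (hist n w)] `&` block s x)
  = (E n Phi * \prod_(i <- s) pr (x i))%:E.
Proof.
elim: n Phi s x => [|m IH] Phi s x us fs.
  rewrite /E /=; case: (Phi [::]).
    rewrite (_ : [set _ | _] = setT) ?setTI ?mul1r ?P_block //.
    by apply/seteqP; split.
  rewrite (_ : [set _ | _] = set0) ?set0I ?mul0r ?measure0 //.
  by apply/seteqP; split.
set c := \prod_(i <- s) _.
have future_le i : future m.+1 i -> future m i.
  by case: i => [[k|k]|k] /=; lia.
have fs' : all (future m) s by apply: sub_all fs.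
have not_in i : ~~ future m.+1 i -> i \notin s.
  by apply: contra => /(allP fs).
case: m IH us fs fs' future_le not_in => [|m] IH us fs fs' future_le not_in.
  (* the first increment reads only its fresh sample *)
  pose x' y (i : nat + nat + nat) : source_type G i :=
    match i return source_type G i with
    | inr k => if k == 0%N then y else x (inr k)
    | j => x j
    end.
  have ns : inr 0%N \notin s by apply: not_in.
  have us' : uniq (inr 0%N :: s) by rewrite /= ns us.
  have fs1 : all (future 0) (inr 0%N :: s) by rewrite /= fs'.
  have setE y : [set w | Phi (hist 1 w)] `&` block s x `&` [set w | Y 1 w = y]
      = [set w | Phi (hist 0 w ++ [:: y])] `&` block (inr 0%N :: s) (x' y).
    rewrite block_cons; apply/seteqP; split => w /=.
      move=> [[ph bl] Yw]; rewrite -Yw -(srrw_X1 H); split => //; split => //.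
      move=> i si; rewrite bl //; case: i si => [[k|k]|k] //= si.
      by case: eqP => // k0; move: ns; rewrite -k0 si.
    move=> [ph [Yw bl]]; rewrite /src /= in Yw; rewrite (srrw_X1 H) Yw.
    split => //; split => // i si; rewrite bl //.
    case: i si => [[k|k]|k] //= si.
    by case: eqP => // k0; move: ns; rewrite -k0 si.
  have IHy y := IH (fun c => Phi (c ++ [:: y])) _ (x' y) us' fs1.
  have [||mA ->] := @measure_partition _ _ _ P G (Y 1)
      ([set w | Phi (hist 1 w)] `&` block s x) (fun y => mu y * (Phi [:: y])%:R * c).
  - by move=> y; rewrite setE; case: (IHy y).
  - move=> y; rewrite setE; case: (IHy y) => _ ->; congr EFin.
    rewrite big_cons /= {1}/pr prob_Y /E /= mulrA [_ * mu y]mulrC; congr (_ * _).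
    rewrite /c; apply: eq_big_seq => i si; congr (pr _).
    case: i si => [[k|k]|k] //= si.
    by case: eqP => // k0; move: ns; rewrite -k0 si.
  split => //; rewrite -mulr_suml; congr ((_ * c)%:E).
  by rewrite /E /= /copy_prob /= subr0 mul1r !mul0r addr0.
pose x' (v : bool * 'I_m.+1 * G) (i : nat + nat + nat) : source_type G i :=
  match i return source_type G i with
  | inl (inl k) => if k == m then v.1.1 else x (inl (inl k))
  | inl (inr k) => if k == m then (m.+1 - v.1.2)%N else x (inl (inr k))
  | inr k => if k == m.+1 then v.2 else x (inr k)
  end.
pose s' := [:: inl (inl m), inl (inr m), inr m.+1 & s] : seq (nat + nat + nat).
have n1 : inl (inl m) \notin s by apply: not_in; rewrite /= ltnn.
have n2 : inl (inr m) \notin s by apply: not_in; rewrite /= ltnn.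
have n3 : inr m.+1 \notin s by apply: not_in; rewrite /= ltnn.
have us' : uniq s' by rewrite /= !inE !negb_or /= n1 n2 n3.
have fs1 : all (future m.+1) s' by rewrite /= !ltnSn.
have x'E v i : i \in s -> x' v i = x i.
  case: i => [[k|k]|k] //= si; case: eqP => // km; exfalso.
  - by move: n1; rewrite -km si.
  - by move: n2; rewrite -km si.
  - by move: n3; rewrite -km si.
(* the position of the copied increment in the history, newest first, is
   [m.+1 - u] *)
pose Z w : bool * 'I_m.+1 * G := (xi m.+2 w, inord (m.+1 - u m.+2 w), Y m.+2 w).
pose Phi' (v : bool * 'I_m.+1 * G) (c : seq G) : bool :=
  Phi ((if v.1.1 then nth 1%g c v.1.2 else v.2) :: c).
have setE v : [set w | Phi (hist m.+2 w)] `&` block s x `&` [set w | Z w = v]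
    = [set w | Phi' v (hist m.+1 w)] `&` block s' (x' v).
  case: v => [[a k] y]; rewrite /s' !block_cons.
  have ZP w : Z w = (a, k, y) <->
      [/\ src (inl (inl m)) w = a, src (inl (inr m)) w = (m.+1 - k)%N
        & src (inr m.+1) w = y].
    have /andP[u1 u2] := @srrw_u_range _ _ _ _ _ _ _ _ _ _ _ _ H m.+2 w isT.
    rewrite /Z /src /=; split.
      move=> [-> <- ->]; split => //; rewrite inordK; lia.
    move=> [-> uk ->]; congr (_, _, _); apply: val_inj => /=.
    by rewrite uk inordK; have := ltn_ord k; lia.
  have XE w : Z w = (a, k, y) ->
     X m.+2 w = if a then nth 1%g (hist m.+1 w) k else y.
    move=> /ZP[Ea Ek Ey]; rewrite (srrw_X H) // -/(src (inl (inl m)) w).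
    rewrite [xi _ _]Ea [u _ _]Ek [Y _ _]Ey; case: (a) => //.
    by rewrite nth_hist.
  apply/seteqP; split => w.
    move=> [[ph bl] Zw]; have [Ea Ek Ey] := (ZP w).1 Zw.
    split; first by rewrite /Phi' /= -(XE w Zw).
    do ! (split; first by rewrite /= eqxx).
    by move=> i si; rewrite x'E // bl.
  move=> [ph [/= Ea [/= Ek [/= Ey bl]]]]; rewrite !eqxx in Ea Ek Ey.
  have Zw : Z w = (a, k, y) by apply/ZP.
  split => //; split; first by rewrite /= (XE w Zw).
  by move=> i si; rewrite bl // x'E.
have IHv v := IH (Phi' v) _ (x' v) us' fs1.
have pxi a : pr (i := inl (inl m)) a = if a then alpha else 1 - alpha.
  rewrite /pr /src /=; case: a; first by rewrite (srrw_xi_law H).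
  have -> : [set w | xi m.+2 w = false] = ~` [set w | xi m.+2 w = true].
    by apply/seteqP; split => w /=; case: (xi m.+2 w).
  by rewrite probability_setC ?(srrw_xi_law H) //; exact: (srrw_xi_rv H).
have pu (k : 'I_m.+1) : pr (i := inl (inr m)) (m.+1 - k)%N = m.+1%:R^-1.
  by rewrite /pr /src /= (srrw_u_law H) //; have := ltn_ord k; lia.
have py y : pr (i := inr m.+1) y = mu y by rewrite /pr /src /= prob_Y.
have [||mA ->] := @measure_partition _ _ _ P _ Z
    ([set w | Phi (hist m.+2 w)] `&` block s x)
    (fun v => E m.+1 (Phi' v) * ((if v.1.1 then alpha else 1 - alpha) *
        (m.+1%:R^-1 * (mu v.2 * c)))).
- by move=> v; rewrite setE; case: (IHv v).
- move=> v; rewrite setE; case: (IHv v) => _ ->; congr EFin.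
  rewrite !big_cons /= !eqxx pxi pu py /c; do 4 congr (_ * _).
  by apply: eq_big_seq => i si; rewrite x'E.
split => //; congr EFin.
have -> : E m.+2 Phi = (1 - alpha) * \sum_y mu y * E m.+1 (fun c => Phi (y :: c))
   + alpha / m.+1%:R * \sum_(k < m.+1) E m.+1 (fun c => Phi (nth 1%g c k :: c)).
  rewrite /E reinforcedS (_ : copy_prob alpha m.+1 = alpha) //.
  rewrite (reinforced_lin _ _ fresh_step_lin) (reinforcedZ _ _ fresh_step_lin).
  rewrite (reinforced_sum _ _ fresh_step_lin); congr (_ * _ + _).
    by apply: eq_bigr => y _; rewrite (reinforcedZ _ _ fresh_step_lin).
  by rewrite (reinforced_sum _ _ fresh_step_lin).
rewrite -(pair_bigA _ (fun ak y => E m.+1 (Phi' (ak, y)) *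
   ((if ak.1 then alpha else 1 - alpha) * (m.+1%:R^-1 * (mu y * c))))) /=.
rewrite -(pair_bigA _ (fun a k => \sum_y E m.+1 (Phi' (a, k, y)) *
   ((if a then alpha else 1 - alpha) * (m.+1%:R^-1 * (mu y * c))))) /=.
rewrite big_bool /= addrC mulrDl; congr (_ + _).
  rewrite (eq_bigr (fun=> (1 - alpha) * m.+1%:R^-1 * c *
      \sum_y mu y * E m.+1 (fun c => Phi (y :: c)))); last first.
    move=> k _; rewrite mulr_sumr; apply: eq_bigr => y _; rewrite /Phi' /=; ring.
  rewrite sumr_const card_ord -mulr_natl.
  by field; rewrite nat1r pnatr_eq0.
rewrite mulr_sumr mulr_suml; apply: eq_bigr => k _; rewrite /Phi' /=.
rewrite (eq_bigr (fun y => alpha / m.+1%:R *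
  E m.+1 (fun c => Phi (nth 1%g c k :: c)) * c * mu y)); last by move=> y _; ring.
by rewrite -mulr_sumr sum_step_mass mulr1.
Qed.

Lemma pmf_hist (W : seq G -> G) n g : (forall w, S n w = W (hist n w)) ->
  Defs.pmf P (S n) g
  = reinforced alpha 1%g fresh_step n (fun c => (W c == g)%:R).
Proof.
move=> SW; have [x _] : exists x : forall i, source_type G i, True.
  by exists (fun i => match i return source_type G i with
    inl (inl _) => true | inl (inr _) => 0%N | inr _ => 1%g end).
have [_] := @hist_law_future n (fun c => W c == g) [::] x isT isT.
rewrite big_nil mulr1 /Defs.pmf.
have -> : [set w | W (hist n w) == g] `&` block [::] x = [set w | S n w = g].
  apply/seteqP; split => w /=; rewrite SW.
    by move=> [/eqP].
  by move=> ->; rewrite eqxx.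
by move=> ->.
Qed.
End History.

(** * The lazy walk on the hypercube *)

Section Hypercube.
Variables (R : realType) (d : nat).
Hypothesis d0 : (0 < d)%N.
Local Notation V := 'rV['Z_2]_d.

Let dR : 0 < d%:R :> R. Proof. by rewrite ltr0n. Qed.
Let dn0 : d%:R != 0 :> R. Proof. exact: lt0r_neq0. Qed.

Definition bitsign (z : 'Z_2) : R := if z == 0 then 1 else -1.

Lemma bitsignD a b : bitsign (a + b) = bitsign a * bitsign b.
Proof.
have bit (z : 'Z_2) : z = 0 \/ z = 1.
  by case: z => [[|[|[]]]] // zlt; [left|right]; exact: val_inj.
rewrite /bitsign; case: (bit a) => ->; case: (bit b) => ->;
  by rewrite ?addr0 ?add0r ?eqxx /= ?mulr1 ?mul1r ?mulrNN ?mulr1.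
Qed.

Lemma bitsign_sqr a : bitsign a * bitsign a = 1.
Proof. by rewrite /bitsign; case: eqP; rewrite ?mulrNN mulr1. Qed.

(** The characters of the hypercube are indexed by sets of coordinates. *)
Definition chi (A : {set 'I_d}) (g : V) : R :=
  \prod_i (if i \in A then bitsign (g 0 i) else 1).

Lemma chiD A g h : chi A (g + h) = chi A g * chi A h.
Proof.
rewrite /chi -big_split /=; apply: eq_bigr => i _.
by case: ifP => _; rewrite ?mulr1 // mxE bitsignD.
Qed.

Lemma chi_sqr A g : chi A g * chi A g = 1.
Proof.
rewrite /chi -big_split /= big1 // => i _.
by case: ifP => _; rewrite ?mulr1 // bitsign_sqr.
Qed.

Lemma chi0 A : chi A 0 = 1.
Proof. by rewrite /chi big1 // => i _; rewrite mxE /bitsign eqxx if_same. Qed.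

Lemma chiB A g h : chi A (g - h) = chi A g * chi A h.
Proof. by rewrite -[in RHS](subrK h g) [in RHS]chiD -mulrA chi_sqr mulr1. Qed.

Lemma chi_delta A k : chi A (delta_mx 0 k) = if k \in A then -1 else 1.
Proof.
rewrite /chi (bigD1 k) //= big1 ?mulr1; last first.
  by move=> i /negbTE ik; rewrite mxE ik andbF /bitsign eqxx if_same.
by rewrite mxE !eqxx.
Qed.

Lemma chi_set0 g : chi finset.set0 g = 1.
Proof. by rewrite /chi big1 // => i _; rewrite inE. Qed.

(** The sum factors over the coordinates, and a coordinate equal to 1 gives the
    factor [1 + -1]. *)
Lemma sum_chi_set g : \sum_A chi A g = (g == 0)%:R * 2 ^+ d.
Proof.
transitivity (\prod_(i < d) (bitsign (g 0 i) + 1)).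
  rewrite bigA_distr; apply: eq_big => // A; by rewrite inE.
have [->|/eqP gn0] := eqVneq g 0.
  rewrite mul1r (eq_bigr (fun=> 2)) ?prodr_const ?card_ord // => i _.
  by rewrite mxE /bitsign eqxx.
rewrite mul0r; have [i gi] : exists i, g 0 i != 0.
  apply/existsP; rewrite -negb_forall; apply/negP => /forallP h.
  by apply: gn0; apply/rowP => i; rewrite mxE; apply/eqP.
by rewrite (bigD1 i) //= /bitsign (negbTE gi) addNr mul0r.
Qed.

Lemma card_cube : #|{: V}| = (2 ^ d)%N.
Proof. by rewrite card_mx card_ord mul1n. Qed.

(** Translating by a basis vector at which [A] and [B] differ changes the sign of
    the summand. *)
Lemma chi_orth A B : \sum_g chi A g * chi B g = (A == B)%:R * 2 ^+ d.
Proof.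
have [->|nAB] := eqVneq A B.
  rewrite (eq_bigr (fun=> 1)) => [|g _]; last exact: chi_sqr.
  by rewrite sumr_const card_cube mul1r natrX.
rewrite mul0r; have [k kAB] : exists k, (k \in A) != (k \in B).
  apply/existsP; rewrite -negb_forall; apply/negP => /forallP h.
  by move: nAB; apply/negP; rewrite negbK; apply/eqP/finset.setP => k; exact/eqP.
set s := \sum_g _; suff : s = - s by lra.
rewrite {1}/s (reindex_inj (addIr (delta_mx 0 k : V))) /= /s -sumrN.
apply: eq_bigr => g _; rewrite !chiD !chi_delta.
by move: kAB; case: (k \in A); case: (k \in B) => // _; ring.
Qed.

(** The mean of the character [A] under one step of the walk, that is the
    eigenvalue of the lazy walk on this character. *)
Definition chi_eigen (A : {set 'I_d}) : R := 1 - #|A|%:R / d%:R.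

Lemma chi_eigen_ge0 A : 0 <= chi_eigen A.
Proof.
rewrite subr_ge0 ler_pdivrMr // mul1r ler_nat.
by rewrite -[X in (_ <= X)%N]card_ord max_card.
Qed.

Lemma chi_eigen_set0 : chi_eigen finset.set0 = 1.
Proof. by rewrite /chi_eigen cards0 mul0r subr0. Qed.

Local Notation mu := (@hypercube_step R d).

Lemma step_sum (f : V -> R) : \sum_(y : V) mu y * f y
  = 2^-1 * f 0 + (2 * d%:R)^-1 * \sum_k f (delta_mx 0 k).
Proof.
have dk k : delta_mx 0 k != 0 :> V.
  by apply/eqP => /rowP /(_ k); rewrite !mxE !eqxx.
rewrite (bigD1 (0 : V)) //= {1}/hypercube_step eqxx; congr (_ + _).
have inj : injective (fun k => delta_mx 0 k : V).
  move=> k l /rowP /(_ k); rewrite !mxE !eqxx /=.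
  by case: eqP.
rewrite mulr_sumr -(big_imset (fun y => (2 * d%:R)^-1 * f y)) /=; last first.
  by move=> k l _ _; exact: inj.
rewrite big_mkcond [RHS]big_mkcond /=; apply: eq_bigr => y _.
have [->|y0] := eqVneq y 0.
  by case: imsetP => // -[k _] /eqP; rewrite eq_sym (negbTE (dk k)).
rewrite /= /hypercube_step (negbTE y0).
have -> : [exists k, y == delta_mx 0 k] = (y \in [set delta_mx 0 x | x : 'I_d]).
  by apply/existsP/imsetP => [[k /eqP yk]|[k _ yk]]; exists k => //; exact/eqP.
by case: ifP => _ //; rewrite mul0r.
Qed.

Lemma step_chi A : \sum_(y : V) mu y * chi A y = chi_eigen A.
Proof.
rewrite step_sum chi0 mulr1 (eq_bigr (fun k => 1 - 2 * (k \in A)%:R)); last first.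
  by move=> k _; rewrite chi_delta; case: (k \in A); rewrite ?mulr1 ?mulr0 //; lra.
rewrite sumrB sumr_const card_ord -mulr_sumr -natr_sum -big_mkcond /= sum1_card.
by rewrite /chi_eigen; field.
Qed.

(** The law of the lazy walk after [k] steps, given by its Fourier expansion. *)
Definition lazy_law (k : nat) (g : V) : R :=
  2 ^- d * \sum_A chi_eigen A ^+ k * chi A g.

Lemma lazy_law0 g : lazy_law 0 g = (g == 0)%:R.
Proof.
rewrite /lazy_law (eq_bigr (fun A => chi A g)) => [|A _]; last by rewrite expr0 mul1r.
by rewrite sum_chi_set mulrC mulfK // expf_neq0.
Qed.

Lemma lazy_lawS k g : lazy_law k.+1 g = \sum_(y : V) mu y * lazy_law k (g - y).
Proof.
rewrite /lazy_law; under [RHS]eq_bigr => y _ do rewrite mulrCA mulr_sumr.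
rewrite -mulr_sumr exchange_big /=; congr (_ * _); apply: eq_bigr => A _.
rewrite exprSr -(step_chi A) mulr_sumr mulr_suml; apply: eq_bigr => y _.
by rewrite chiB; ring.
Qed.

Lemma lazy_law_ge0 k g : 0 <= lazy_law k g.
Proof.
elim: k g => [|k IH] g; first by rewrite lazy_law0.
rewrite lazy_lawS; apply: sumr_ge0 => y _; rewrite mulr_ge0 //.
rewrite /hypercube_step; case: ifP => _; first by rewrite invr_ge0.
by case: ifP => _ //; rewrite invr_ge0 mulr_ge0 // ltW.
Qed.

Lemma lazy_law_chi k A : \sum_g lazy_law k g * chi A g = chi_eigen A ^+ k.
Proof.
rewrite /lazy_law; under eq_bigr => g _ do rewrite -mulrA mulr_suml.
rewrite -mulr_sumr exchange_big /= (bigD1 A) //= [X in _ + X]big1 ?addr0.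
  under eq_bigr => g _ do rewrite -mulrA.
  by rewrite -mulr_sumr chi_orth eqxx mul1r mulrCA mulVf ?mulr1 // expf_neq0.
move=> B BA; under eq_bigr => g _ do rewrite -mulrA.
by rewrite -mulr_sumr chi_orth (negbTE BA) mul0r mulr0.
Qed.

Lemma sum_lazy_law k : \sum_g lazy_law k g = 1.
Proof.
rewrite -(expr1n R k) -chi_eigen_set0 -lazy_law_chi; apply: eq_bigr => g _.
by rewrite chi_set0 mulr1.
Qed.

Lemma lazy_law_sqr k : \sum_g lazy_law k g ^+ 2 = 2 ^- d * \sum_A chi_eigen A ^+ (2 * k).
Proof.
transitivity (\sum_g 2 ^- d * \sum_A chi_eigen A ^+ k * (lazy_law k g * chi A g)).
  apply: eq_bigr => g _; rewrite expr2 {2}/lazy_law mulrCA; congr (_ * _).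
  by rewrite mulr_sumr; apply: eq_bigr => A _; rewrite mulrCA.
rewrite -mulr_sumr exchange_big /=; congr (_ * _); apply: eq_bigr => A _.
by rewrite -mulr_sumr lazy_law_chi -exprD mul2n addnn.
Qed.

(** By [1 - x <= exp (- x)] the summand is at most [q ^ #|A|] with
    [q = exp (- 2 k / d)], and these powers sum to [(1 + q) ^ d <= exp (d q)]. *)
Lemma sum_chi_eigen_le k : \sum_A chi_eigen A ^+ (2 * k)
  <= expR (d%:R * expR (- (2 * k%:R / d%:R))).
Proof.
set q := expR (- _).
have -> : expR (d%:R * q) = expR q ^+ d by rewrite expRM_natl.
apply: le_trans (_ : (q + 1) ^+ d <= _); last first.
  by rewrite lerXn2r ?nnegrE ?addr_ge0 ?expR_ge0 // addrC expR_ge1Dx.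
have -> : (q + 1) ^+ d = \prod_(i < d) (q + 1) by rewrite prodr_const card_ord.
rewrite bigA_distr big_mkcond /=; apply: ler_sum => A _.
rewrite -big_mkcond /= prodr_const.
have -> : q ^+ #|A| = expR (- (#|A|%:R / d%:R)) ^+ (2 * k).
  rewrite -!expRM_natl; congr expR; rewrite natrM; ring.
by rewrite lerXn2r ?nnegrE ?chi_eigen_ge0 ?expR_ge0 // /chi_eigen expR_ge1Dx.
Qed.

Local Notation U := (@unif R (hypercube d)).

Lemma unifE g : U g = 2 ^- d.
Proof.
have E : #|hypercube d| = (2 ^ d)%N by rewrite -card_cube.
by rewrite /unif E natrX.
Qed.

Lemma sum_unif : \sum_g U g = 1.
Proof.
rewrite (eq_bigr (fun=> 2 ^- d)) => [|g _]; last exact: unifE.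
have E : #|hypercube d| = (2 ^ d)%N by rewrite -card_cube.
rewrite sumr_const E.
by rewrite -[_ *+ _]mulr_natl natrX mulfV // expf_neq0.
Qed.

(** By Parseval, the squared L2 distance between the density of the walk and 1 is
    the sum of [chi_eigen A ^ (2 k)] over the nonempty [A]. The total variation is
    compared to it through [2 |a| <= (2 ^ d / eps) a ^ 2 + eps / 2 ^ d], which
    avoids square roots. *)
Lemma tv_lazy_law_le k (eps : R) : 0 < eps ->
  expR (d%:R * expR (- (2 * k%:R / d%:R))) - 1 <= eps ^+ 2 ->
  tv_dist (lazy_law k) U <= eps / 2.
Proof.
move=> e0 he.
have D0 : 0 < 2 ^+ d :> R by rewrite exprn_gt0.
have sq : \sum_g (lazy_law k g - U g) ^+ 2 <= 2 ^- d * eps ^+ 2.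
  have -> : \sum_g (lazy_law k g - U g) ^+ 2
      = \sum_g (lazy_law k g ^+ 2 - 2 * 2 ^- d * lazy_law k g + 2 ^- d * U g).
    by apply: eq_bigr => g _; rewrite !unifE; ring.
  rewrite big_split /= -mulr_sumr sum_unif sumrB -mulr_sumr sum_lazy_law lazy_law_sqr.
  have h : 2 ^- d * (\sum_A chi_eigen A ^+ (2 * k) - 1) <= 2 ^- d * eps ^+ 2.
    rewrite ler_wpM2l ?invr_ge0 ?(ltW D0) //.
    by apply: le_trans he; rewrite lerB // sum_chi_eigen_le.
  by apply: le_trans h; lra.
have amgm (a : R) : `|a| <= 2^-1 * (2 ^+ d / eps * a ^+ 2 + eps * 2 ^- d).
  set D := 2 ^+ d in D0 *; set r := `|a|.
  have -> : a ^+ 2 = r ^+ 2 by rewrite /r real_normK ?num_real.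
  rewrite -subr_ge0.
  have -> : 2^-1 * (D / eps * r ^+ 2 + eps / D) - r
     = 2^-1 * (D / eps) * (r - eps / D) ^+ 2 by field; lra.
  by rewrite mulr_ge0 ?sqr_ge0 // mulr_ge0 ?invr_ge0 // divr_ge0 // ltW.
rewrite /tv_dist; apply: le_trans (_ : 2^-1 * (2^-1 * (eps + eps)) <= _); last first.
  by lra.
rewrite ler_wpM2l ?invr_ge0 //.
apply: le_trans (ler_sum _ (fun g _ => amgm (lazy_law k g - U g))) _.
rewrite -mulr_sumr ler_wpM2l ?invr_ge0 // big_split /= -mulr_sumr.
apply: lerD.
  apply: le_trans (ler_wpM2l _ sq) _; first by rewrite divr_ge0 // ltW.
  by rewrite le_eqVlt; apply/orP; left; apply/eqP; field; lra.
have E : #|hypercube d| = (2 ^ d)%N by rewrite -card_cube.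
rewrite sumr_const E.
by rewrite -[_ *+ _]mulr_natl natrX mulrCA mulfV ?mulr1 // expf_neq0.
Qed.

Lemma tv_lazy_law_le1 k : tv_dist (lazy_law k) U <= 1.
Proof.
rewrite /tv_dist -[leRHS](@mulVf _ 2) // ler_wpM2l ?invr_ge0 //.
have -> : 2 = \sum_g (lazy_law k g + U g) by rewrite big_split /= sum_lazy_law sum_unif; lra.
apply: ler_sum => g _; apply: le_trans (ler_normB _ _) _.
rewrite !ger0_norm ?lazy_law_ge0 //.
by rewrite unifE invr_ge0 exprn_ge0.
Qed.

(** The number of zero coordinates minus the number of ones. *)
Definition magnetization (g : V) : R := \sum_i chi [set i] g.

Lemma lazy_law_mag k : \sum_g lazy_law k g * magnetization g = d%:R * (1 - d%:R^-1) ^+ k.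
Proof.
rewrite /magnetization; under eq_bigr => g _ do rewrite mulr_sumr.
rewrite exchange_big /= (eq_bigr (fun=> (1 - d%:R^-1) ^+ k)).
  by rewrite sumr_const card_ord mulr_natl.
by move=> i _; rewrite lazy_law_chi /chi_eigen cards1 mul1r.
Qed.

Lemma magnetization_sqr g : magnetization g ^+ 2 =
  d%:R + \sum_i \sum_(j | j != i) chi [set i] g * chi [set j] g.
Proof.
rewrite expr2 /magnetization mulr_suml.
transitivity (\sum_i (1 + \sum_(j | j != i) chi [set i] g * chi [set j] g)).
  by apply: eq_bigr => i _; rewrite mulr_sumr (bigD1 i) //= chi_sqr.
by rewrite big_split /= sumr_const card_ord.
Qed.

Lemma chi_pair i j g : j != i ->
  chi [set i] g * chi [set j] g = chi [set i; j] g.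
Proof.
move=> ji; rewrite /chi -big_split /=; apply: eq_bigr => l _.
rewrite !inE; have [->|li] := eqVneq l i; last by rewrite mul1r.
by rewrite eq_sym (negbTE ji) mulr1.
Qed.

(** Distinct coordinates have nonpositive correlation under the lazy walk, since
    [1 - 2 / d <= (1 - 1 / d) ^ 2]. *)
Lemma lazy_law_mag_sqr k :
  \sum_g lazy_law k g * magnetization g ^+ 2 <= d%:R + (d%:R * (1 - d%:R^-1) ^+ k) ^+ 2.
Proof.
have -> : \sum_g lazy_law k g * magnetization g ^+ 2
   = d%:R + \sum_i \sum_(j | j != i) chi_eigen [set i; j] ^+ k.
  under eq_bigr => g _ do rewrite magnetization_sqr mulrDr mulr_sumr.
  rewrite big_split /= -mulr_suml sum_lazy_law mul1r; congr (_ + _).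
  rewrite exchange_big /=; apply: eq_bigr => i _.
  under eq_bigr => g _ do rewrite mulr_sumr.
  rewrite exchange_big /=; apply: eq_bigr => j ji; rewrite -lazy_law_chi.
  by apply: eq_bigr => g _; rewrite chi_pair.
rewrite lerD2l.
have -> : (d%:R * (1 - d%:R^-1) ^+ k) ^+ 2
    = \sum_(i < d) \sum_(j < d) ((1 - d%:R^-1) ^+ 2) ^+ k :> R.
  rewrite sumr_const card_ord sumr_const card_ord -mulrnA -[RHS]mulr_natl natrM.
  by rewrite exprMn -!exprM (mulnC k) -expr2.
apply: ler_sum => i _; rewrite big_mkcond /=; apply: ler_sum => j _.
case: ifP => ji; last by rewrite exprn_ge0 ?sqr_ge0.
rewrite lerXn2r ?nnegrE ?chi_eigen_ge0 ?sqr_ge0 // /chi_eigen cards2 eq_sym ji /=.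
by have := sqr_ge0 (d%:R^-1 : R); lra.
Qed.

Lemma lazy_law_mag_var k (M := d%:R * (1 - d%:R^-1) ^+ k) :
  \sum_g lazy_law k g * (magnetization g - M) ^+ 2 <= d%:R.
Proof.
have -> : \sum_g lazy_law k g * (magnetization g - M) ^+ 2
  = \sum_g (lazy_law k g * magnetization g ^+ 2
      - 2 * M * (lazy_law k g * magnetization g) + M ^+ 2 * lazy_law k g).
  by apply: eq_bigr => g _; ring.
rewrite big_split sumrB /= -mulr_sumr -mulr_sumr sum_lazy_law lazy_law_mag -/M.
by have := lazy_law_mag_sqr k; rewrite -/M; lra.
Qed.

(** Chebyshev's inequality: the mean is at least [2 t] and the variance at most
    [d]. *)
Lemma lazy_law_mag_small k (t : R) : 0 < t -> 2 * t <= d%:R * (1 - d%:R^-1) ^+ k ->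
  \sum_g lazy_law k g * (magnetization g < t)%R%:R <= d%:R / t ^+ 2.
Proof.
move=> t0 tM; rewrite ler_pdivlMr ?exprn_gt0 // mulr_suml.
apply: le_trans (lazy_law_mag_var k); apply: ler_sum => g _.
rewrite -mulrA ler_wpM2l ?lazy_law_ge0 //.
case: ltP => mt; last by rewrite mul0r sqr_ge0.
by rewrite mul1r; set M := d%:R * _ in tM *; nra.
Qed.

Lemma unif_magnetization_large (t : R) : 0 < t ->
  \sum_g U g * (t <= magnetization g)%R%:R <= d%:R / t ^+ 2.
Proof.
move=> t0; rewrite ler_pdivlMr ?exprn_gt0 // mulr_suml.
apply: le_trans (_ : \sum_g 2 ^- d * magnetization g ^+ 2 <= _).
  apply: ler_sum => g _; rewrite unifE -mulrA ler_wpM2l ?invr_ge0 ?exprn_ge0 //.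
  by case: (leP t) => mt; [rewrite mul1r; nra|rewrite mul0r sqr_ge0].
under eq_bigr => g _ do rewrite magnetization_sqr mulrDr mulr_sumr.
rewrite big_split /= -mulr_suml.
have -> : \sum_(g : V) 2 ^- d = 1 :> R.
  by apply: etrans sum_unif; apply: eq_bigr => g _; rewrite unifE.
rewrite mul1r [X in _ + X](_ : _ = 0) ?addr0 //.
rewrite exchange_big /= big1 // => i _.
under eq_bigr => g _ do rewrite mulr_sumr.
rewrite exchange_big /= big1 // => j ji.
rewrite -mulr_sumr chi_orth (_ : [set i] == [set j] = false) ?mul0r ?mulr0 //.
by apply/negbTE; apply: contra ji => /eqP/set1_inj ->.
Qed.
End Hypercube.

Lemma tv_ge_mass (R : realType) (G : finType) (p q : G -> R) (A : pred G) :
  \sum_g p g = 1 -> \sum_g q g = 1 ->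
  1 - \sum_g p g * (~~ A g)%:R - \sum_g q g * (A g)%:R <= tv_dist p q.
Proof.
move=> sum_p sum_q.
have -> : 1 - \sum_g p g * (~~ A g)%:R - \sum_g q g * (A g)%:R
    = 2^-1 * \sum_g (p g - q g) * ((A g)%:R - (~~ A g)%:R).
  have -> : \sum_g (p g - q g) * ((A g)%:R - (~~ A g)%:R)
      = \sum_g (p g - 2 * (p g * (~~ A g)%:R) + (q g - 2 * (q g * (A g)%:R))).
    by apply: eq_bigr => g _; case: (A g); rewrite /=; ring.
  by rewrite big_split !sumrB /= -!mulr_sumr sum_p sum_q; field.
rewrite /tv_dist ler_wpM2l ?invr_ge0 //; apply: ler_sum => g _.
apply: le_trans (ler_norm _) _; rewrite normrM ler_piMr //.
by case: (A g); rewrite /= ?subr0 ?sub0r ?normrN normr1.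
Qed.

Section WalkLaw.
Variables (R : realType) (d : nat) (alpha : R).
Hypothesis d0 : (0 < d)%N.
Hypothesis alpha01 : 0 < alpha < 1.
Local Notation V := 'rV['Z_2]_d.
Local Notation mu := (@hypercube_step R d).

(** The position of the walk is the sum for the constant bits [true]; the other
    bits arise when copies are removed. *)
Definition bitsum (n : nat) (b : nat -> bool) (c : seq V) : V :=
  \sum_(k < n) (if b k then nth 0 c k else 0).

Lemma bitsum_cons m b x c :
  bitsum m.+1 b (x :: c) = (if b 0%N then x else 0) + bitsum m (tailb b) c.
Proof. by rewrite /bitsum big_ord_recl. Qed.

Lemma bitsum_flip m b c k : (k < m)%N ->
  bitsum m (flipb b k) c = nth 0 c k + bitsum m b c.
Proof.
move=> km; rewrite /bitsum (bigD1 (Ordinal km)) //= [in RHS](bigD1 (Ordinal km)) //= addrA.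
have xx (x : V) : x + x = 0.
  apply/rowP => i; rewrite !mxE; case: (x 0 i) => [[|[|[]]]] // zlt; exact: val_inj.
congr (_ + _).
  by rewrite /flipb eqxx addbT; case: (b k); rewrite ?addr0 ?xx.
apply: eq_bigr => l lk; rewrite /flipb (_ : (l == k :> nat) = false) ?addbF //.
by apply: contraNF lk => /eqP lk; apply/eqP/val_inj.
Qed.

(** The key duality. In a group of exponent two, a copy of position [k] adds its
    value to the sum exactly as flipping the bit at [k] does, and a fresh sample
    makes one step of the lazy walk; this is the recursion of [odd_expect]. *)
Lemma reinforced_bitsum n b (g : V) :
  reinforced alpha (0 : V) (@fresh_step R (hypercube d) mu) n
    (fun c => (bitsum n b c == g)%:R)
  = odd_expect alpha n b (fun k => lazy_law R k g).
Proof.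
have lin := @fresh_step_lin R (hypercube d) mu.
elim: n b g => [|m IH] b g; first by rewrite /= /bitsum big_ord0 lazy_law0 // eq_sym.
rewrite reinforcedS (reinforced_lin _ _ lin) (reinforcedZ _ _ lin).
rewrite 2!(reinforced_sum _ _ lin) /=.
under eq_bigr => y _ do rewrite (reinforcedZ _ _ lin).
case b0E: (b 0%N); last first.
  have sum1 : \sum_(y : V) mu y = 1.
    have := @step_sum R d (fun=> 1); under eq_bigr => y _ do rewrite mulr1.
    move=> ->; rewrite sumr_const card_ord; field.
    by rewrite pnatr_eq0 -lt0n.
  rewrite (eq_bigr (fun y : V =>
    mu y * odd_expect alpha m (tailb b) (fun k => lazy_law R k g))).
    rewrite -mulr_suml sum1 mul1r.
    rewrite (@copy_prob_sum _ _ _ _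
      (odd_expect alpha m (tailb b) (fun k => lazy_law R k g))); first by ring.
    move=> k; rewrite -IH; congr reinforced; apply/funext => c.
    by rewrite bitsum_cons b0E add0r.
  move=> y _; rewrite -IH; congr (_ * reinforced _ _ _ _ _); apply/funext => c.
  by rewrite bitsum_cons b0E add0r.
congr (_ * _ + _ * _).
  have -> : (fun k => lazy_law R k g) \o S
      = (fun k => \sum_(y : V) mu y * lazy_law R k (g - y)).
    by apply/funext => k /=; rewrite lazy_lawS.
  rewrite odd_expect_sum; apply: eq_bigr => y _; rewrite odd_expectZ -IH.
  congr (_ * reinforced _ _ _ _ _); apply/funext => c.
  rewrite bitsum_cons b0E; congr ((nat_of_bool _)%:R).
  by rewrite [RHS]eq_sym subr_eq [LHS]eq_sym addrC.
apply: eq_bigr => k _; rewrite -IH; congr reinforced; apply/funext => c.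
by rewrite bitsum_cons b0E bitsum_flip.
Qed.

Lemma pmf_srrw (disp : measure_display) (T : measurableType disp)
    (P : probability T R) (S : nat -> T -> hypercube d) n g :
  is_srrw P mu alpha S ->
  Defs.pmf P (S n) g = odd_expect alpha n (fun=> true) (fun k => lazy_law R k g).
Proof.
move=> [xi [u [Y [X H]]]]; rewrite -reinforced_bitsum.
apply: (pmf_hist H) => w; elim: n => [|n IH].
  by rewrite (srrw_S0 H) /= /bitsum big_ord0.
by rewrite (srrw_S H) //= bitsum_cons IH FinRing.zmodMgE addrC.
Qed.

(** The total variation is convex, so the law of the walk is compared to uniform
    by splitting according to whether the number of odd clusters reaches [k1]. *)
Lemma tv_upper n (eps : R) (k1 : nat) : 0 < eps ->
  expR (d%:R * expR (- (2 * k1%:R / d%:R))) - 1 <= eps ^+ 2 ->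
  tv_dist (fun g : hypercube d => odd_expect alpha n (fun=> true) (fun k => lazy_law R k g))
    (@unif R _)
  <= odd_expect alpha n (fun=> true) (fun k => (k < k1)%N%:R) + eps / 2.
Proof.
move=> e0 he; set b := fun=> true.
rewrite -[X in _ + X](odd_expect_const alpha n b) -odd_expectD.
have -> : tv_dist (fun g : hypercube d =>
    odd_expect alpha n b (fun k => lazy_law R k g)) (@unif R _)
  = 2^-1 * \sum_(g : hypercube d) `|odd_expect alpha n b (fun k => lazy_law R k g - unif R g)|.
  congr (_ * _); apply: eq_bigr => g _; congr (`|_|).
  by rewrite odd_expectD odd_expect_const.
apply: le_trans (_ : 2^-1 * \sum_(g : hypercube d)
   odd_expect alpha n b (fun k => `|lazy_law R k g - unif R g|) <= _).
  by rewrite ler_wpM2l ?invr_ge0 //; apply: ler_sum => g _; exact: ler_norm_odd_expect.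
rewrite -odd_expect_sum -odd_expectZ; apply: odd_expect_le => // k.
rewrite -/(tv_dist (lazy_law R k) _).
case: ltnP => [kk|kk] /=.
  by apply: le_trans (tv_lazy_law_le1 R d0 k) _; rewrite lerDl divr_ge0 // ltW.
rewrite add0r; apply: tv_lazy_law_le => //; apply: le_trans he.
rewrite lerD2r ler_expR ler_pM2l ?ltr0n // ler_expR lerN2.
by rewrite ler_pM2r ?invr_gt0 ?ltr0n // ler_pM2l // ler_nat.
Qed.

(** The vectors with magnetization at least [t] are rare under the uniform law,
    but typical for the lazy walk up to time [k0]. *)
Lemma tv_lower n (t : R) (k0 : nat) : 0 < t ->
  2 * t <= d%:R * (1 - d%:R^-1) ^+ k0 ->
  1 - odd_expect alpha n (fun=> true) (fun k => (k0 < k)%N%:R) - 2 * (d%:R / t ^+ 2)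
  <= tv_dist (fun g : hypercube d => odd_expect alpha n (fun=> true) (fun k => lazy_law R k g))
    (@unif R _).
Proof.
move=> t0 ht; set b := fun=> true.
pose p (g : hypercube d) := odd_expect alpha n b (fun k => lazy_law R k g).
have sum_p : \sum_g p g = 1.
  rewrite /p -odd_expect_sum -[RHS](odd_expect_const alpha n b).
  by apply: eq_odd_expect => k; rewrite sum_lazy_law.
have dd : 0 <= d%:R / t ^+ 2 by rewrite divr_ge0 // sqr_ge0.
have pB : \sum_g p g * (magnetization R g < t)%R%:R
    <= odd_expect alpha n b (fun k => (k0 < k)%N%:R) + d%:R / t ^+ 2.
  have -> : \sum_g p g * (magnetization R g < t)%R%:R
     = odd_expect alpha n b (fun k =>
         \sum_(g : V) lazy_law R k g * (magnetization R g < t)%R%:R).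
    rewrite odd_expect_sum; apply: eq_bigr => g _.
    by rewrite mulrC -odd_expectZ; apply: eq_odd_expect => k; rewrite mulrC.
  rewrite -[X in _ + X](odd_expect_const alpha n b) -odd_expectD; apply: odd_expect_le => // k.
  case: ltnP => kk /=.
    rewrite ler_wpDr //; apply: le_trans (_ : \sum_g lazy_law R k g <= _).
      by apply: ler_sum => g _; apply: ler_piMr; [exact: lazy_law_ge0|rewrite lern1 leq_b1].
    by rewrite sum_lazy_law.
  rewrite add0r; apply: lazy_law_mag_small => //; apply: le_trans ht _.
  rewrite ler_wpM2l //; apply: ler_wiXn2l => //.
  by rewrite subr_ge0 invf_le1 ?ltr0n // ler1n.
have := @unif_magnetization_large R d t t0.
set q := @unif R (hypercube d) => qA.
have sum_q : \sum_g q g = 1 by exact: sum_unif.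
have := tv_ge_mass [pred g | t <= magnetization R g] sum_p sum_q.
under eq_bigr => g _ do rewrite /= -ltNge.
move=> key; apply: le_trans key; rewrite /=; lra.
Qed.
End WalkLaw.

(** * Cutoff *)

Section CutoffBounds.
Variables (R : realType) (alpha : R).
Hypothesis alpha01 : 0 < alpha < 1.
Local Notation F := (hyp2F1 1 alpha^-1 (alpha^-1 + 1) 2^-1 : R).

(** The asymptotic number of odd clusters per unit of time. *)
Definition speed : R := (1 - alpha) * F / 2.

Lemma speed_gt0 : 0 < speed.
Proof.
case/andP: alpha01 => a0 a1; have := hyp_ge1 alpha01.
by move=> F1; rewrite divr_gt0 // mulr_gt0 //; lra.
Qed.

(** From [ln z <= z] at [z = y ^ (1 - g)]. *)
Lemma powR_le_div_ln (g x y : R) : 0 < g < 1 -> 1 < x -> x <= y ->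
  y `^ g <= (1 - g)^-1 * (y / ln x).
Proof.
case/andP=> g0 g1 x1 xy; have lx := ln_gt0 x1; have y0 : 0 < y by lra.
have lxy : ln x <= ln y by rewrite ler_ln ?posrE //; lra.
have h : (1 - g) * ln y <= y `^ (1 - g).
  by rewrite -ln_powR ltW // ln_sublinear // powR_gt0.
have yE : y `^ g * y `^ (1 - g) = y.
  rewrite -powRD; first by rewrite addrC subrK powRr1 // ltW.
  by apply/implyP => _; exact: lt0r_neq0.
rewrite mulrC mulrAC -mulrA -invfM ler_pdivlMr; last by rewrite mulr_gt0 //; lra.
rewrite -[leRHS]yE ler_wpM2l ?powR_ge0 //; apply: le_trans h.
by rewrite ?[ln x * _]mulrC ler_wpM2l // subr_ge0 ltW.
Qed.

Local Notation law n phi := (odd_expect alpha n (fun=> true) phi).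

(** The errors [n ^ alpha] of the mean and [n ^ (1/2)] of the fluctuations are
    both absorbed in [K n / ln d], which is of order [d] at the mixing time. *)
Lemma odd_clusters_concentrate (eta : R) : 0 < eta -> exists2 K : R, 0 < K &
  forall (d n : nat) (A : pred nat), (2 <= d)%N -> (d <= n)%N ->
    (forall k, A k -> K * (n%:R / ln d%:R) <= `|k%:R - speed * n%:R|) ->
    law n (fun k => (A k)%:R) <= eta.
Proof.
move=> eta0; case/andP: alpha01 => a0 a1.
have c0 : 0 < (2 + 8 / alpha) * (1 - alpha)^-1.
  by apply: mulr_gt0; [rewrite addr_gt0 // divr_gt0|rewrite invr_gt0; lra].
have s0 : 0 < Num.sqrt eta^-1 by rewrite sqrtr_gt0 invr_gt0.
exists ((2 + 8 / alpha) * (1 - alpha)^-1 + Num.sqrt eta^-1 * 2).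
  by rewrite addr_gt0 // mulr_gt0.
move=> d n A d2 dn hA.
have d1 : 1 < d%:R :> R by rewrite ltr1n.
have dnR : d%:R <= n%:R :> R by rewrite ler_nat.
have n0 : (0 < n)%N by apply: leq_trans dn; exact: ltnW.
have nR : 0 < n%:R :> R by rewrite ltr0n.
have sn0 : 0 < Num.sqrt n%:R :> R by rewrite sqrtr_gt0.
have p1 := powR_le_div_ln alpha01 d1 dnR.
have half : 0 < (2^-1 : R) < 1 by apply/andP; split; lra.
have p2 := powR_le_div_ln half d1 dnR.
rewrite powR12_sqrt ?(ltW nR) // in p2.
have h2 : (1 - 2^-1)^-1 = 2 :> R by field; lra.
rewrite h2 in p2.
have na1 : 1 <= n%:R `^ alpha.
  have e1 : 1 `^ alpha = 1 :> R by rewrite powR1.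
  by rewrite -[leLHS]e1; apply: ge0_ler_powR; rewrite ?nnegrE ?(ltW a0) ?ler1n.
pose s := Num.sqrt eta^-1 * Num.sqrt n%:R.
have sgt0 : 0 < s by exact: mulr_gt0.
have mean := odd_mean_asymptotics alpha01 n0.
rewrite -/speed in mean.
have -> : eta = n%:R / s ^+ 2.
  rewrite /s exprMn !sqr_sqrtr ?invr_ge0 ?(ltW nR) ?(ltW eta0) //.
  by field; apply/andP; split; exact: lt0r_neq0.
apply: odd_expect_chebyshev => // k Ak; have := hA k Ak => {hA} dev.
have tri : `|k%:R - speed * n%:R| <= `|k%:R - odd_mean alpha n (fun=> true)|
   + `|odd_mean alpha n (fun=> true) - speed * n%:R|.
  by apply: le_trans (ler_normD _ _); rewrite addrA subrK.
have b1 : 2 + 8 / alpha * n%:R `^ alpha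
   <= (2 + 8 / alpha) * ((1 - alpha)^-1 * (n%:R / ln d%:R)).
  apply: le_trans (_ : (2 + 8 / alpha) * n%:R `^ alpha <= _).
    by rewrite [leRHS]mulrDl lerD ?ler_peMr.
  by rewrite ler_wpM2l // addr_ge0 // divr_ge0 // ltW.
have b2 : s <= Num.sqrt eta^-1 * (2 * (n%:R / ln d%:R)).
  by rewrite /s ler_wpM2l // ltW.
move: dev mean tri b1 b2; rewrite mulrDl -!mulrA.
set a := (2 + 8 / alpha) * _; set b := Num.sqrt eta^-1 * _.
set v := 8 * _.
set X := `|k%:R - _|; set Y := `|k%:R - odd_mean _ _ _|; set Z := `|odd_mean _ _ _ - _|.
by move=> *; lra.
Qed.

(** At time [n] the number of odd clusters is at least
    [n (speed - K / ln d)] with high probability. Beyond the stated time this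
    exceeds [(d ln d) / 2 + B d], where [B] is chosen so that the bound of
    [tv_lazy_law_le] holds with equality. *)
Lemma tv_small_after (eps : R) : 0 < eps < 1 ->
  exists C lam0 : R, forall d n : nat, (2 <= d)%N -> lam0 <= ln d%:R ->
    d%:R * ln d%:R / (2 * speed) + C * d%:R <= n%:R ->
    tv_dist (fun g : hypercube d => law n (fun k => lazy_law R k g)) (@unif R _) <= eps.
Proof.
case/andP => e0 e1; have c0 := speed_gt0; set c := speed in c0 *.
have [K K0 conc] := odd_clusters_concentrate (divr_gt0 e0 (ltr0Sn R 1)).
pose x := ln (1 + eps ^+ 2).
have x0 : 0 < x by apply: ln_gt0; rewrite ltrDl exprn_gt0.
pose B := - (2^-1 * ln x).
have B0 : 0 <= B.
  rewrite oppr_ge0 mulr_ge0_le0 ?invr_ge0 //; apply: ln_le0.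
  have h : x <= eps ^+ 2 by apply: le_ln1Dx; have := sqr_ge0 eps; lra.
  by apply: le_trans h _; rewrite exprn_ile1 // ltW.
exists (Num.max 1 ((K / c + 2 * B) / c)), (2 * K / c) => d n d2 l0 hn.
have dR : 0 < d%:R :> R by rewrite ltr0n ltnW.
have d0 : (0 < d)%N by exact: ltnW.
set C := Num.max _ _ in hn.
have C1 : 1 <= C by rewrite /C le_max lexx.
have C2 : (K / c + 2 * B) / c <= C by rewrite /C le_max lexx orbT.
set l := ln d%:R in l0 hn *.
have lpos : 0 < l by apply: lt_le_trans l0; rewrite divr_gt0 // mulr_gt0.
have t00 : 0 <= d%:R * l / (2 * c).
  by apply: divr_ge0; apply: mulr_ge0 => //; apply: ltW.
have dn : (d <= n)%N.
  rewrite -(ler_nat R); apply: le_trans hn; rewrite ler_wpDl //.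
  by rewrite ler_peMl // ltW.
pose y := 2^-1 * (d%:R * l) + B * d%:R.
pose k1 := (Num.truncn y).+1.
have y0 : 0 <= y.
  by apply: addr_ge0; apply: mulr_ge0; rewrite ?invr_ge0 ?mulr_ge0 ?(ltW lpos) ?(ltW dR).
have yk1 : y <= k1%:R by have /andP[_ /ltW] := truncn_itv y0.
have expB : expR (d%:R * expR (- (2 * k1%:R / d%:R))) - 1 <= eps ^+ 2.
  rewrite lerBlDl -[leRHS](@lnK R) ?posrE; last by rewrite ltr_wpDr ?sqr_ge0.
  rewrite ler_expR -/x.
  have -> : x = d%:R * expR (- (2 * y / d%:R)).
    have -> : - (2 * y / d%:R) = ln x - l by rewrite /y /B; field; lra.
    rewrite expRB !lnK ?posrE // mulrCA mulfV ?mulr1 //; exact: lt0r_neq0.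
  rewrite ler_wpM2l ?(ltW dR) // ler_expR lerN2.
  by rewrite ler_wpM2r ?invr_ge0 ?(ltW dR) // ler_wpM2l.
apply: le_trans (tv_upper d0 alpha01 n e0 expB) _.
suff bad : law n (fun k => (k < k1)%N%:R) <= eps / 2 by lra.
apply: (conc d n) => // k; rewrite /k1 ltnS => kk.
have ky : k%:R <= y by rewrite -truncn_ge_nat.
rewrite -/c -/l.
have Kl : K / l <= c / 2.
  by rewrite ler_pdivrMr // mulrC; move: l0; rewrite ler_pdivrMr //; lra.
have key : y <= n%:R * (c - K / l).
  apply: le_trans (_ : (d%:R * l / (2 * c) + C * d%:R) * (c - K / l) <= _); last first.
    by rewrite ler_wpM2r //; lra.
  have -> : (d%:R * l / (2 * c) + C * d%:R) * (c - K / l)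
    = 2^-1 * (d%:R * l) - d%:R * (K / c) / 2 + C * d%:R * (c - K / l).
    by field; apply/andP; split; exact: lt0r_neq0.
  have : C * d%:R * (c / 2) <= C * d%:R * (c - K / l).
    by rewrite ler_wpM2l ?mulr_ge0 //; lra.
  have : (K / c + 2 * B) / c * d%:R * (c / 2) <= C * d%:R * (c / 2).
    apply: ler_wpM2r; first by rewrite divr_ge0 // ltW.
    by apply: ler_wpM2r => //; exact: ltW.
  have -> : (K / c + 2 * B) / c * d%:R * (c / 2) = d%:R * (K / c) / 2 + B * d%:R.
    by field; exact: lt0r_neq0.
  rewrite /y; set u := C * d%:R * (c - _); set v := C * _ * _; set w := d%:R * (K / c) / 2.
  by move=> *; lra.
rewrite distrC; apply: le_trans (ler_norm _).
have -> : K * (n%:R / l) = n%:R * (K / l) by rewrite mulrCA.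
by move: key; rewrite mulrBr [c * _]mulrC; lra.
Qed.

(** From [1 / (1 - 1/d) = 1 + 1 / (d - 1) <= exp (1 / (d - 1))]. *)
Lemma expr_1BV_ge (d k : nat) : (2 <= d)%N ->
  expR (- (k%:R / (d%:R - 1))) <= (1 - d%:R^-1) ^+ k :> R.
Proof.
move=> d2; have d11 : 0 < d%:R - 1 :> R by rewrite subr_gt0 ltr1n.
have dR : 0 < d%:R :> R by rewrite ltr0n ltnW.
have base : expR (- (d%:R - 1)^-1) <= 1 - d%:R^-1 :> R.
  rewrite expRN -[leRHS]invrK lef_pV2 ?posrE ?expR_gt0 //; last first.
    by rewrite invr_gt0 subr_gt0 invf_lt1 // ltr1n.
  have -> : (1 - d%:R^-1)^-1 = 1 + (d%:R - 1)^-1 :> R.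
    by field; rewrite !lt0r_neq0.
  exact: expR_ge1Dx.
rewrite -mulrN expRM_natl lerXn2r // nnegrE ?expR_ge0 //.
exact: le_trans (expR_ge0 _) base.
Qed.

(** When [k] stays below [(d ln d) / 2] by a multiple of [d], the mean
    [d (1 - 1/d) ^ k] of the magnetization is still at least [a] times
    [d ^ (1/2)], the order of its fluctuations. *)
Lemma magnetization_large (d k : nat) (a : R) : (2 <= d)%N -> 1 <= a ->
  k%:R <= 2^-1 * (d%:R * ln d%:R) - (ln a + 2^-1) * d%:R ->
  a * Num.sqrt d%:R <= d%:R * (1 - d%:R^-1) ^+ k.
Proof.
move=> d2 a1 hk; have a0 : 0 < a := lt_le_trans ltr01 a1.
have d11 : 0 < d%:R - 1 :> R by rewrite subr_gt0 ltr1n.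
have dR : 0 < d%:R :> R by rewrite ltr0n ltnW.
have sd0 : 0 < Num.sqrt d%:R :> R by rewrite sqrtr_gt0.
have sdd : Num.sqrt d%:R ^+ 2 = d%:R :> R by rewrite sqr_sqrtr // ltW.
have ll : ln d%:R <= d%:R - 1 :> R.
  have := @le_ln1Dx R (d%:R - 1); rewrite (_ : 1 + (d%:R - 1) = d%:R); last by ring.
  by apply; apply: lt_trans d11; rewrite ltrN10.
set B := ln a + 2^-1 in hk; set l := ln d%:R in hk ll.
have kl : k%:R / (d%:R - 1) <= 2^-1 * l - ln a :> R.
  rewrite ler_pdivrMr //; apply: le_trans hk _; rewrite -subr_ge0.
  have -> : (2^-1 * l - ln a) * (d%:R - 1) - (2^-1 * (d%:R * l) - B * d%:R)
     = ln a + 2^-1 * (d%:R - l) by rewrite /B; field.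
  rewrite addr_ge0 ?ln_ge0 // mulr_ge0 ?invr_ge0 // subr_ge0.
  by apply: le_trans ll _; rewrite lerBlDr lerDl.
apply: le_trans (_ : d%:R * expR (- (2^-1 * l - ln a)) <= _); last first.
  rewrite ler_wpM2l ?(ltW dR) //; apply: le_trans (expr_1BV_ge k d2).
  by rewrite ler_expR lerN2.
rewrite opprB expRB lnK ?posrE //.
have -> : expR (2^-1 * l) = Num.sqrt d%:R.
  by rewrite mulrC expRM lnK ?posrE // powR12_sqrt // ltW.
have -> : d%:R * (a / Num.sqrt d%:R) = a * Num.sqrt d%:R.
  rewrite -[X in X * _]sdd; field; exact: lt0r_neq0.
exact: lexx.
Qed.

(** Three small probabilities use up half of [1 - eps]: a quarter goes to the event
    of too many odd clusters, and an eighth to each of the two errors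
    [d / t ^ 2] in [tv_lower], which fixes [a]. *)
Lemma tv_large_before (eps : R) : 0 < eps < 1 ->
  exists C lam0 : R, forall d n : nat, (2 <= d)%N -> lam0 <= ln d%:R ->
    (d <= n)%N -> n%:R <= d%:R * ln d%:R / (2 * speed) - C * d%:R ->
    eps < tv_dist (fun g : hypercube d => law n (fun k => lazy_law R k g)) (@unif R _).
Proof.
case/andP => e0 e1; have c0 := speed_gt0; set c := speed in c0 *.
have eta0 : 0 < (1 - eps) / 4 by rewrite divr_gt0 //; lra.
have [K K0 conc] := odd_clusters_concentrate eta0.
pose a := Num.sqrt (8 / (1 - eps)).
have a8 : 0 < 8 / (1 - eps) by rewrite divr_gt0 //; lra.
have a0 : 0 < a by rewrite sqrtr_gt0.
have asq : a ^+ 2 = 8 / (1 - eps) by rewrite sqr_sqrtr // ltW.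
have a1 : 1 <= a.
  rewrite -[leLHS]sqrtr1 ler_wsqrtr // ler_pdivlMr; lra.
pose B := ln (2 * a) + 2^-1.
have B0 : 0 < B by rewrite ltr_wpDl // ln_ge0 //; lra.
exists ((K / (2 * c) + B) / c), (2 * B) => d n d2 l0 dn hn.
have dR : 0 < d%:R :> R by rewrite ltr0n ltnW.
have d0 : (0 < d)%N by exact: ltnW.
set C := (_ / c) in hn.
have C0 : 0 < C by rewrite divr_gt0 // addr_gt0 // divr_gt0 // mulr_gt0.
set l := ln d%:R in l0 hn *.
have lpos : 0 < l by apply: lt_le_trans l0; rewrite mulr_gt0.
pose y := 2^-1 * (d%:R * l) - B * d%:R.
have y0 : 0 <= y.
  have -> : y = 2^-1 * (d%:R * (l - 2 * B)) by rewrite /y; field.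
  by rewrite mulr_ge0 ?invr_ge0 // mulr_ge0 ?(ltW dR) // subr_ge0.
pose k0 := Num.truncn y.
have /andP[k0y yk0] := truncn_itv y0; rewrite -/k0 in k0y yk0.
pose t := a * Num.sqrt d%:R.
have sd0 : 0 < Num.sqrt d%:R :> R by rewrite sqrtr_gt0.
have sdd : Num.sqrt d%:R ^+ 2 = d%:R :> R by rewrite sqr_sqrtr // ltW.
have t0 : 0 < t by exact: mulr_gt0.
have ht : 2 * t <= d%:R * (1 - d%:R^-1) ^+ k0.
  rewrite /t mulrA; apply: magnetization_large => //; first by rewrite mulr_ege1 // ler1n.
apply: lt_le_trans (tv_lower d0 alpha01 n t0 ht).
have dt : d%:R / t ^+ 2 = (1 - eps) / 8.
  have ne1 : 1 - eps != 0 by rewrite gt_eqF // subr_gt0.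
  by rewrite /t exprMn asq sdd; field; rewrite ne1 lt0r_neq0.
rewrite dt; clear dt ht.
suff bad : law n (fun k => (k0 < k)%N%:R) <= (1 - eps) / 4 by lra.
apply: (conc d n) => // k kk; rewrite -/c -/l.
have yk : y <= k%:R by apply: le_trans (ltW yk0) _; rewrite ler_nat.
have Kl0 : 0 < K / l by exact: divr_gt0.
have key : n%:R * (c + K / l) <= y.
  apply: le_trans (_ : _ <= (d%:R * l / (2 * c) - C * d%:R) * (c + K / l)) _.
    by rewrite ler_wpM2r //; lra.
  have -> : (d%:R * l / (2 * c) - C * d%:R) * (c + K / l)
     = 2^-1 * (d%:R * l) + d%:R * (K / (2 * c)) - C * d%:R * c - C * d%:R * (K / l).
    by field; apply/andP; split; exact: lt0r_neq0.
  have : 0 <= C * d%:R * (K / l).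
    by apply: mulr_ge0; [apply: mulr_ge0; exact: ltW|exact: ltW].
  have -> : C * d%:R * c = d%:R * (K / (2 * c)) + B * d%:R.
    by rewrite /C; field; exact: lt0r_neq0.
  rewrite /y; set u := C * _ * _; set w := d%:R * (K / _).
  by move=> *; lra.
apply: le_trans (ler_norm _).
have -> : K * (n%:R / l) = n%:R * (K / l) by rewrite mulrCA.
by move: key; rewrite mulrDr [c * _]mulrC; lra.
Qed.
End CutoffBounds.

Lemma abse_sub_le (R : realType) (x : \bar R) (r c : R) :
  ((r - c)%:E <= x)%E -> (x <= (r + c)%:E)%E -> (`|x - r%:E| <= c%:E)%E.
Proof.
case: x => [x| |] //=; rewrite !lee_fin => h1 h2.
by rewrite ler_norml; apply/andP; split; lra.
Qed.

Theorem theorem1p5 (R : realType) (alpha eps : R)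
    (halpha : 0 < alpha < 1) (heps : 0 < eps < 1) :
  exists (C : R) (d0 : nat), forall d : nat, (d0 <= d)%N -> (1 <= d)%N ->
    forall (disp : measure_display) (T : measurableType disp)
      (P : probability T R) (S : nat -> T -> hypercube d),
    is_srrw P (@hypercube_step R d) alpha S ->
    (`| tmix P S eps
        - (d%:R * ln d%:R
           / ((1 - alpha) * hyp2F1 1 alpha^-1 (alpha^-1 + 1) 2%:R^-1))%:E |
     <= (C * d%:R)%:E)%E.
Proof.
have [C1 [lam1 upper]] := tv_small_after halpha heps.
have [C2 [lam2 lower]] := tv_large_before halpha heps.
have c0 := speed_gt0 halpha; set c := speed alpha in c0 upper lower.
have cE : (1 - alpha) * hyp2F1 1 alpha^-1 (alpha^-1 + 1) 2%:R^-1 = 2 * c.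
  by rewrite /c /speed; field.
rewrite cE.
pose lam := Num.max (Num.max lam1 lam2) (Num.max 0 (2 * c * (C2 + 2))).
exists (Num.max `|C1| `|C2| + 1), (maxn 2 (Num.truncn (expR lam)).+1).
move=> d; rewrite geq_max => /andP[d2 dlam] _ disp T P S HS.
have d1 : (0 < d)%N by exact: ltnW.
have dR : 0 < d%:R :> R by rewrite ltr0n.
have d1R : 1 <= d%:R :> R by rewrite ler1n.
have law m : tv_dist (Defs.pmf P (S m)) (@unif R (hypercube d)) = tv_dist
    (fun g : hypercube d => odd_expect alpha m (fun=> true) (fun k => lazy_law R k g))
    (@unif R _).
  by congr tv_dist; apply/funext => g; exact: pmf_srrw.
have lam_ln : lam <= ln d%:R.
  rewrite -[leLHS](@expRK R) ler_ln ?posrE ?expR_gt0 //.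
  have /andP[_ h] := truncn_itv (expR_ge0 lam).
  by apply: le_trans (ltW h) _; rewrite ler_nat.
move: (lam_ln); rewrite /lam !ge_max => /andP[/andP[l1 l2] /andP[l3 l4]].
set l := ln d%:R in l1 l2 l3 l4 *; set t0 := d%:R * l / (2 * c).
have t00 : 0 <= t0 by apply: divr_ge0; apply: mulr_ge0 => //; exact: ltW.
set M := Num.max _ _.
have M1 : C1 <= M by rewrite le_max ler_norm.
have M2 : C2 <= M by rewrite le_max ler_norm orbT.
have M0 : 0 <= M by rewrite le_max normr_ge0.
have M1d : C1 * d%:R <= M * d%:R by rewrite ler_wpM2r // ltW.
have M2d : C2 * d%:R <= M * d%:R by rewrite ler_wpM2r // ltW.
have Md0 : 0 <= M * d%:R by rewrite mulr_ge0 // ltW.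
apply: abse_sub_le; last first.
  pose y := t0 + M * d%:R.
  have y0 : 0 <= y by rewrite addr_ge0.
  have /andP[yl yr] := truncn_itv y0.
  apply: ge_ereal_inf; exists ((Num.truncn y).+1%:R)%:E; last first.
    rewrite lee_fin -natr1 mulrDl mul1r addrA; apply: lerD => //.
  exists (Num.truncn y).+1 => //; split => // m ym.
  rewrite law; apply: upper => //; apply: le_trans (_ : y <= _).
    by rewrite -/l -/t0 /y; lra.
  by apply: le_trans (ltW yr) _; rewrite ler_nat.
apply: le_ereal_inf_tmp => _ [n [n1 hn] <-]; rewrite lee_fin.
pose y := t0 - C2 * d%:R.
have dy : d%:R + 1 <= y.
  have : d%:R * (C2 + 2) <= t0.
    rewrite /t0 -mulrA ler_wpM2l ?(ltW dR) // ler_pdivlMr; first by rewrite mulrC.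
    by rewrite mulr_gt0.
  by rewrite /y mulrDr [d%:R * C2]mulrC; lra.
have y0 : 0 <= y by lra.
have /andP[yl yr] := truncn_itv y0.
suff : (Num.truncn y < n)%N.
  rewrite -(ler_nat R) => h.
  by have := le_trans (ltW yr) h; rewrite mulrDl mul1r /y; lra.
rewrite ltnNge; apply/negP => /hn; rewrite law leNgt => /negP; apply.
apply: lower => //.
by rewrite truncn_ge_nat //; lra.
Qed.
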